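(* Let $\xi=\{\xi_{ml}\}_{m\ge 0,\,0\le l\le L_m}$ be a subnormal sequence and let $a_{ml}$ ($m\ge 0$, $0\le l\le L_m$) be real numbers. Suppose there exist an increasing sequence $n_0<n_1<n_2<\cdots$ of positive integers and constants $C_1,C_2>0$ such that for all $k$ we have $g(n_{k+1})\le C_1 g(n_k)$ and $$\sum_{j=1}^k \sqrt{\Big(\sum_{m=n_{j-1}+1}^{n_j}|\mathbf a_m|^2\Big)\log n_j}\le C_2\, g(n_k).$$ Then $$u(x,\xi)=\sum_{m=0}^\infty\sum_{l=0}^{L_m} a_{ml}\,\xi_{ml}\, r^m\, Y_{ml}\Big(\frac{x}{r}\Big),\qquad r=|x|,$$ belongs to $h^\infty_v(\mathbf B)$ almost surely.
   Context: Let $d\ge 1$, let $\mathbf B$ be the open unit ball of $\mathbf R^{d+1}$ and $S^d$ its boundary sphere. The weight $v$ is a positive increasing continuous function on $[0,1)$ with $v(0)=1$, $\lim_{r\to 1}v(r)=+\infty$, satisfying the doubling condition $v(1-t)\le D\,v(1-2t)$ for $0<t\le 1/2$ and some constant $D$. Define $g:[1,\infty)\to[1,\infty)$ by $g(x)=v(1-1/x)$; the doubling condition is equivalent to $g(2x)\le D g(x)$. $h^\infty_v(\mathbf B)$ is the set of harmonic functions $u:\mathbf B\to\mathbf R$ such that $|u(x)|\le K v(|x|)$ on $\mathbf B$ for some $K>0$. For each $m\ge 0$, $Y_{m0},\dots,Y_{mL_m}$ are real spherical harmonics of degree $m$ on $S^d$ (finitely many, $L_m$ depending on the dimension), normalized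 so that $\|Y_{ml}\|_\infty\le 1$ on $S^d$; $r^mY_{ml}(x/r)$ is the corresponding homogeneous harmonic polynomial of degree $m$. Write $\mathbf a_m=(a_{m0},\dots,a_{mL_m})$ and $|\mathbf a_m|^2=\sum_{l=0}^{L_m}|a_{ml}|^2$. A real random variable $\omega$ is subnormal if $\mathcal E(e^{\lambda\omega})\le e^{\lambda^2/2}$ for all $\lambda\in\mathbf R$ ($\mathcal E$ denotes expectation). A subnormal sequence is a sequence of independent subnormal random variables. *)

(* Defs.v *)
From mathcomp Require Import all_boot all_order all_algebra.
From mathcomp Require Import all_classical all_reals all_analysis.
(* The notations of mpoly clash with those of mathcomp-analysis. *)
From mathcomp Require Import -(notations) mpoly.

Set Implicit Arguments.
Unset Strict Implicit.
Unset Printing Implicit Defensive.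

Import Order.TTheory GRing.Theory Num.Theory.
Import numFieldNormedType.Exports.

Local Open Scope classical_set_scope.
Local Open Scope ring_scope.

(* The library norm `|x| of a row vector is the sup norm. *)
Definition euclidean_norm (R : realType) (n : nat) (x : 'rV[R]_n) : R :=
  Num.sqrt (\sum_(i < n) x ord0 i ^+ 2).

Definition open_unit_ball (R : realType) (n : nat) : set 'rV[R]_n :=
  [set x | euclidean_norm x < 1].

Definition unit_sphere (R : realType) (n : nat) : set 'rV[R]_n :=
  [set x | euclidean_norm x = 1].

Definition partial (R : realType) (d : nat) (i : 'I_d.+1)
    (u : 'rV[R]_d.+1 -> R) : 'rV[R]_d.+1 -> R :=
  fun x => 'D_(delta_mx ord0 i) u x.

(* A is meant to be open. *)
Definition C2_on (R : realType) (d : nat) (A : set 'rV[R]_d.+1)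
    (u : 'rV[R]_d.+1 -> R) : Prop :=
  forall x, A x ->
  [/\ {for x, continuous u},
      forall i, derivable u x (delta_mx ord0 i)
        /\ {for x, continuous (partial i u)}
    & forall i j, derivable (partial i u) x (delta_mx ord0 j)
        /\ {for x, continuous (partial j (partial i u))}].

Definition laplacian (R : realType) (d : nat)
    (u : 'rV[R]_d.+1 -> R) : 'rV[R]_d.+1 -> R :=
  fun x => \sum_(i < d.+1) partial i (partial i u) x.

Definition harmonic_on (R : realType) (d : nat) (A : set 'rV[R]_d.+1)
    (u : 'rV[R]_d.+1 -> R) : Prop :=
  C2_on A u /\ forall x, A x -> laplacian u x = 0.

Definition poly_fun (R : realType) (n : nat) (p : mpoly.mpoly n R) :
    'rV[R]_n -> R :=
  fun x => mpoly.meval (fun i => x ord0 i) p.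

(* A spherical harmonic of degree m is the restriction to the unit sphere of a
   homogeneous harmonic polynomial of degree m; it determines that polynomial
   and is represented by it. *)
Definition spherical_harmonic (R : realType) (d m : nat)
    (Y : mpoly.mpoly d.+1 R) : Prop :=
  Y \is mpoly.ishomog1 m (@mpoly.mdeg d.+1) /\ harmonic_on setT (poly_fun Y).

Record growth_weight (R : realType) (v : R -> R) : Prop := GrowthWeight {
  weight_gt0 : forall r, 0 <= r < 1 -> 0 < v r ;
  weight_homo : forall r s, 0 <= r -> r <= s -> s < 1 -> v r <= v s ;
  weight_continuous : {within `[0, 1[, continuous v} ;
  weight0 : v 0 = 1 ;
  weight_cvg : v r @[r --> 1^'-] --> +oo ;
  weight_doubling : exists D : R,
    forall t, 0 < t -> t <= 1 / 2 -> v (1 - t) <= D * v (1 - 2 * t) }.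

Definition weight_g (R : realType) (v : R -> R) : R -> R :=
  fun x => v (1 - 1 / x).

Definition h_infty (R : realType) (d : nat) (v : R -> R)
    (u : 'rV[R]_d.+1 -> R) : Prop :=
  harmonic_on (@open_unit_ball R d.+1) u /\
  exists2 K : R, 0 < K & forall x, open_unit_ball x ->
    `|u x| <= K * v (euclidean_norm x).

Definition subnormal (disp : measure_display) (T : measurableType disp)
    (R : realType) (P : probability T R) (X : {RV P >-> R}) : Prop :=
  forall t : R, ('M_P X t <= (expR (t ^+ 2 / 2))%:E)%E.

Arguments subnormal {disp T R} P X.

Definition mutually_independent (disp : measure_display)
    (T : measurableType disp) (R : realType) (P : probability T R)
    (I : eqType) (X : I -> {RV P >-> R}) : Prop :=
  forall (s : seq I) (B : I -> set R), uniq s ->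
    (forall i, measurable (B i)) ->
    P (\bigcap_(i in [set` s]) (X i @^-1` B i)) =
    (\prod_(i <- s) P (X i @^-1` B i))%E.

Arguments mutually_independent {disp T R} P {I} X.

Definition subnormal_sequence (disp : measure_display)
    (T : measurableType disp) (R : realType) (P : probability T R)
    (L : nat -> nat) (xi : forall m, 'I_(L m).+1 -> {RV P >-> R}) : Prop :=
  mutually_independent P
    (fun i : {m : nat & 'I_(L m).+1} => xi (tag i) (tagged i)) /\
  forall m l, subnormal P (xi m l).

Arguments subnormal_sequence {disp T R} P {L} xi.

Definition coef_sqnorm (R : realType) (L : nat -> nat)
    (a : forall m, 'I_(L m).+1 -> R) (m : nat) : R :=
  \sum_(l < (L m).+1) a m l ^+ 2.

(* The degree m term of the expansion in spherical harmonics with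
   coefficients c, at the point x.  At x = 0 one has r^-1 *: x = 0, and
   since Y m l is a homogeneous polynomial the value is still that of the
   corresponding solid harmonic, including when m = 0. *)
Definition expansion_term (R : realType) (d : nat) (L : nat -> nat)
    (Y : forall m, 'I_(L m).+1 -> mpoly.mpoly d.+1 R)
    (c : forall m, 'I_(L m).+1 -> R) (x : 'rV[R]_d.+1) (m : nat) : R :=
  let r := euclidean_norm x in
  \sum_(l < (L m).+1) c m l * r ^+ m * poly_fun (Y m l) (r^-1 *: x).

(* Main.v *)
(* Fix a block n_k < m <= n_(k+1) and a degree m in it.  The partial block sum
   of the terms of degree n_k < i <= m is, on the sphere, a polynomial of degree
   at most m, and at each point it is subgaussian with variance at most the sum
   of |a_i|^2 over the block.  Its supremum over the sphere is controlled by its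
   values on a net of polynomial size in m: Auerbach's lemma gives a net with a
   loss polynomial in the degree, and applying it to the m-th power of the
   polynomial makes the loss bounded.  A union bound over the net and
   Borel-Cantelli bound almost surely all but finitely many of these partial
   block sums by a multiple of sqrt((sum of |a_i|^2 over the block) log n_(k+1)),
   so by the hypotheses the full partial sums satisfy |S_m| <= C g(m + 1) on the
   sphere.  Abel summation then gives
   |u(r y)| <= (1 - r) sum_m r^m |S_m(y)| <= C' v(r), the last step because the
   doubling condition yields g(m + 1) r^m <= C v(r) ((1 + r) / 2)^m.

   The series may be differentiated term by term because a weak Markov
   inequality bounds the partial derivatives of a polynomial of degree m, on a
   smaller ball, by its supremum times a factor quadratic in m. *)

Require Import Defs.
From mathcomp Require Import all_boot all_order all_algebra.
From mathcomp Require Import all_classical all_reals all_analysis.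
From mathcomp Require Import -(notations) mpoly.
From mathcomp Require Import finmap perm measurable_realfun.
From mathcomp Require Import lra ring zify.

Import Order.TTheory GRing.Theory Num.Theory.
Import numFieldNormedType.Exports.

Local Open Scope classical_set_scope.
Local Open Scope ring_scope.

Set Implicit Arguments.
Unset Strict Implicit.
Unset Printing Implicit Defensive.

(** * Growth of the weight *)

Lemma bernoulli (R : realType) (h : R) (n : nat) :
  0 <= h -> 1 + n%:R * h <= (1 + h) ^+ n.
Proof.
move=> h0; elim: n => [|n IH]; first by rewrite mul0r addr0 expr0.
rewrite exprS; apply: (@le_trans _ _ ((1 + h) * (1 + n%:R * h))); last first.
  by apply: ler_wpM2l => //; lra.
rewrite -natr1.
have : 0 <= n%:R * h * h by rewrite !mulr_ge0.
by nra.
Qed.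

Section Weight.
Variables (R : realType) (v : R -> R).
Hypothesis hv : growth_weight v.

Let g := weight_g v.

Lemma weight_g_homo (x y : R) : 1 <= x -> x <= y -> g x <= g y.
Proof.
move=> x1 xy; have x0 : 0 < x by lra.
have y0 : 0 < y by lra.
rewrite /g /weight_g !div1r.
have hx : x^-1 <= 1 by rewrite invf_le1.
have hy : 0 < y^-1 by rewrite invr_gt0.
have hxy : y^-1 <= x^-1 by rewrite lef_pV2.
by apply: (weight_homo hv); lra.
Qed.

Lemma weight_ge1 (r : R) : 0 <= r -> r < 1 -> 1 <= v r.
Proof. by move=> r0 r1; rewrite -(weight0 hv); apply: (weight_homo hv). Qed.

Lemma weight_g_ge1 (x : R) : 1 <= x -> 1 <= g x.
Proof.
move=> x1; have x0 : 0 < x by lra.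
apply: weight_ge1; rewrite div1r.
- by rewrite subr_ge0 invf_le1.
- by rewrite ltrBlDr ltrDl invr_gt0.
Qed.

Lemma weight_g_inv (r : R) : r < 1 -> g (1 - r)^-1 = v r.
Proof. by move=> r1; rewrite /g /weight_g div1r invrK; congr v; lra. Qed.

Lemma weight_g_double :
  exists2 D : R, 1 <= D & forall x, 1 <= x -> g (2 * x) <= D * g x.
Proof.
have [D hD] := weight_doubling hv.
exists D => [|x x1].
  (* At [t = 1/2] the doubling condition reads [v (1/2) <= D * v 0 = D], and [v (1/2) >= 1]. *)
  have := hD (1 / 2) ltac:(lra) (lexx _).
  have -> : 1 - 2 * (1 / 2) = 0 :> R by lra.
  have := @weight_ge1 (1 - 1 / 2) ltac:(lra) ltac:(lra).
  by rewrite (weight0 hv); lra.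
have x0 : 0 < x by lra.
have := hD (1 / (2 * x)); rewrite !div1r invfM.
have xi : 0 < x^-1 by rewrite invr_gt0.
have xi1 : x^-1 <= 1 by rewrite invf_le1.
rewrite /g /weight_g !div1r invfM.
have -> : 1 - 2 * (2^-1 * x^-1) = 1 - x^-1 by lra.
by apply; nra.
Qed.

(* For i > 4 D x, halving i costs a factor D, which (1 + 1 / (2 x)) ^ (i / 2)
   absorbs. *)
Lemma weight_g_growth : exists2 C : R, 0 < C &
  forall (x : R) (i : nat), 1 <= x ->
    g i.+1%:R <= C * g x * (1 + (2 * x)^-1) ^+ i.
Proof.
have [D D1 hD] := weight_g_double.
have hDk k x : 1 <= x -> g (2 ^+ k * x) <= D ^+ k * g x.
  move=> x1; elim: k => [|k IH]; first by rewrite !expr0 !mul1r.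
  rewrite !exprS -!mulrA; apply: (le_trans (hD _ _)).
    rewrite -[leLHS]mul1r; apply: ler_pM => //.
    by apply: exprn_ege1; lra.
  by apply: ler_wpM2l => //; lra.
(* With [8 * D <= 2 ^+ k], every [i <= 4 * D * x] satisfies [i + 1 <= 2 ^+ k * x], so [k] doublings
   settle the small indices. *)
have [k hk] : exists k : nat, 8 * D <= 2 ^+ k.
  exists (Num.bound (8 * D)); apply: (@le_trans _ _ (Num.bound (8 * D))%:R).
    by apply/ltW/archi_boundP; lra.
  by rewrite -natrX ler_nat; apply/ltnW/ltn_expl.
have Dk : 1 <= D ^+ k by apply: exprn_ege1.
exists (D ^+ k) => [|x i x1]; first by lra.
have x0 : 0 < x by lra.
have gx : 1 <= g x by apply: weight_g_ge1.
set h := (2 * x)^-1.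
have h0 : 0 < h by rewrite invr_gt0; lra.
have hx : h * (2 * x) = 1 by rewrite /h mulVf //; lra.
have ph j : 1 <= (1 + h) ^+ j by apply: exprn_ege1; lra.
elim/ltn_ind: i => i IH.
have [small|big] := lerP i%:R (4 * D * x).
  have i0 : 0 <= i%:R :> R by [].
  apply: (@le_trans _ _ (g (2 ^+ k * x))).
    apply: weight_g_homo; rewrite -natr1; first by lra.
    have : 8 * D * x <= 2 ^+ k * x by apply: ler_wpM2r => //; lra.
    by nra.
  apply: (le_trans (hDk k x x1)).
  rewrite -[leLHS]mulr1; apply: ler_wpM2l => //.
  by rewrite mulr_ge0; lra.
have ipos : (0 < i)%N by rewrite -(ltr_nat R); nra.
have hlt : (i./2 < i)%N.
  rewrite -[X in (_ < X)%N]odd_double_half -addnn.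
  by case: (odd i) (i./2) ipos (odd_double_half i) => [] [|j] //=; lia.
have split_i : i = (uphalf i + i./2)%N.
  by rewrite uphalf_half -addnA addnn odd_double_half.
have ui : i%:R <= 2 * (uphalf i)%:R :> R.
  rewrite -natrM ler_nat mul2n -addnn {1}split_i leq_add2l uphalf_half.
  by rewrite leq_addl.
apply: (@le_trans _ _ (D * g (i./2).+1%:R)).
  apply: (le_trans _ (hD _ _)); last by rewrite ler1n.
  apply: weight_g_homo; first by rewrite ler1n.
  rewrite -natrM ler_nat -[X in (X < _)%N]odd_double_half -mul2n.
  by case: (odd i) => /=; lia.
rewrite {2}split_i exprD.
(* Here [uphalf i >= i / 2 > 2 * D * x], so Bernoulli with [h = 1 / (2 * x)] gives at least
   [1 + D]. *)
have u1 : D <= (1 + h) ^+ uphalf i.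
  apply: le_trans (bernoulli _ _); last exact: ltW.
  by nra.
apply: (le_trans (ler_wpM2l _ (IH _ hlt))); first by lra.
have A0 : 0 <= D ^+ k * g x by rewrite mulr_ge0; lra.
have := ph (i./2).
set A := D ^+ k * g x in A0 *; set B := (1 + h) ^+ i./2; set U := _ ^+ uphalf i in u1 *.
move=> B1; have -> : D * (A * B) = (A * B) * D by ring.
have -> : A * (U * B) = A * B * U by ring.
by apply: ler_wpM2l => //; rewrite mulr_ge0 //; lra.
Qed.

(** Take [x = (1 - r)^-1] in [weight_g_growth], so that [g x = v r]; the ratio becomes
    [r (1 + (1 - r) / 2)], which is [(1 + r) / 2] minus [(1 - r)^2 / 2]. *)
Lemma weight_g_geometric : exists2 C : R, 0 < C &
  forall (r : R) (m : nat), 0 <= r -> r < 1 ->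
    g m.+1%:R * r ^+ m <= C * v r * ((1 + r) / 2) ^+ m.
Proof.
have [C C0 hC] := weight_g_growth.
exists C => // r m r0 r1.
have r1' : 0 < 1 - r by lra.
have x1 : 1 <= (1 - r)^-1 by rewrite invf_ge1 //; lra.
have := hC _ m x1; rewrite weight_g_inv // invfM invrK => hm.
apply: (le_trans (ler_wpM2r (exprn_ge0 m r0) hm)).
rewrite -[leLHS]mulrA -exprMn; apply: ler_wpM2l.
  by rewrite mulr_ge0 //; have := weight_ge1 r0 r1; lra.
have [a b] : 0 <= (1 + 2^-1 * (1 - r)) * r /\ (1 + 2^-1 * (1 - r)) * r <= (1 + r) / 2.
  by split; nra.
by apply: lerXn2r => //; rewrite nnegrE //; lra.
Qed.

End Weight.

(** Summation by parts for a finite sum, hence the boundary term; it replaces the terms by their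
    partial sums, which are what is estimated on the sphere. *)
Lemma abel_geometric (R : realType) (U : nat -> R) (r : R) (N : nat) :
  \sum_(m < N.+1) r ^+ m * U m =
  (1 - r) * \sum_(m < N.+1) r ^+ m * \sum_(i < m.+1) U i
  + r ^+ N.+1 * \sum_(i < N.+1) U i.
Proof.
elim: N => [|N IH]; first by rewrite !big_ord1 /= expr0 expr1; ring.
rewrite big_ord_recr IH /= [in RHS]big_ord_recr /=.
rewrite [\sum_(i < N.+2) U i]big_ord_recr /=.
set s := \sum_(i < N.+1) U i; set t := \sum_(m < N.+1) _.
by rewrite [r ^+ N.+2]exprS; ring.
Qed.

(** * A weak Markov inequality *)

Section Chebyshev.
Variable R : realType.

(** Carrying the consecutive pair [T_k], [T_(k+1)] of Chebyshev polynomials of the first kind makes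
    the three-term recurrence structural. *)
Fixpoint chebyshev2 (k : nat) : {poly R} * {poly R} :=
  if k is k'.+1 then
    let: (p, q) := chebyshev2 k' in (q, 2%:P * 'X * q - p)
  else (1, 'X).

Definition chebyshev k := (chebyshev2 k).1.

Lemma chebyshevSS k :
  chebyshev k.+2 = 2%:P * 'X * chebyshev k.+1 - chebyshev k.
Proof. by rewrite /chebyshev /=; case: (chebyshev2 k). Qed.

Lemma chebyshev_cos k (t : R) : (chebyshev k).[cos t] = cos (k%:R * t).
Proof.
elim/ltn_ind: k => -[_|[_|k IH]].
- by rewrite /chebyshev /= hornerE mul0r cos0.
- by rewrite /chebyshev /= hornerX mul1r.
rewrite chebyshevSS !hornerE !IH //.
have -> : k.+2%:R * t = k.+1%:R * t + t by rewrite -natr1; ring.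
have -> : k%:R * t = k.+1%:R * t - t by rewrite -natr1; ring.
by rewrite cosB cosD; ring.
Qed.

Lemma size_chebyshev k : size (chebyshev k) = k.+1.
Proof.
elim/ltn_ind: k => -[_|[_|k IH]].
- by rewrite /chebyshev /= size_poly1.
- by rewrite /chebyshev /= size_polyX.
rewrite chebyshevSS -mulrA.
have s1 : size (2%:P * ('X * chebyshev k.+1)) = k.+3.
  rewrite size_Cmul ?pnatr_eq0 // mulrC size_mulX ?IH //.
  by rewrite -size_poly_gt0 IH.
by rewrite size_polyDl s1 // size_polyN IH.
Qed.

(** Differentiating the recurrence at 0 gives [T_(k+2)'(0) = 2 T_(k+1)(0) - T_k'(0)], and
    [T_(k+1)(0) = cos ((k+1) pi / 2)] is at most 1 in absolute value. *)
Lemma chebyshev_deriv0 k : `|(chebyshev k)^`().[0]| <= k%:R.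
Proof.
elim/ltn_ind: k => -[_|[_|k IH]].
- by rewrite /chebyshev /= derivC horner0 normr0.
- by rewrite /chebyshev /= derivX hornerC normr1.
rewrite chebyshevSS derivD derivN !derivM derivC derivX !hornerE.
rewrite ?(mulr0, mul0r, add0r, addr0, mulr1).
have h1 : `|(chebyshev k.+1).[0]| <= 1.
  by rewrite -(@cos_pihalf R) chebyshev_cos ler_norml cos_geN1 cos_le1.
have h2 := IH k (leqnSn k.+1).
apply: (le_trans (ler_normB _ _)); rewrite normrM normr_nat.
rewrite -[in leRHS](natr1 k.+1) -[in leRHS](natr1 k).
by move: h1 h2; set a := `|_|; set b := `|_|; lra.
Qed.

Lemma poly_chebyshev_expansion n (p : {poly R}) : (size p <= n)%N ->
  exists c : nat -> R, p = \sum_(k < n) c k *: chebyshev k.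
Proof.
elim: n p => [|n IH] p sp.
  by exists (fun=> 0); rewrite big_ord0; apply/eqP; rewrite -size_poly_leq0.
have l0 : lead_coef (chebyshev n) != 0.
  by rewrite lead_coef_eq0 -size_poly_gt0 size_chebyshev.
pose b := p`_n / lead_coef (chebyshev n).
have [|c hc] := IH (p - b *: chebyshev n).
  apply/leq_sizeP => j; rewrite leq_eqVlt => /predU1P[<-|nj].
    rewrite coefB coefZ /b lead_coefE size_chebyshev /= mulfVK ?subrr //.
    by move: l0; rewrite lead_coefE size_chebyshev.
  rewrite coefB coefZ (nth_default _ (leq_trans sp nj)).
  by rewrite [(chebyshev n)`_j]nth_default ?size_chebyshev // mulr0 subr0.
exists (fun k => if k == n then b else c k).
rewrite big_ord_recr /= eqxx -[LHS](subrK (b *: chebyshev n)) hc.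
by congr (_ + _); apply: eq_bigr => i _; rewrite ltn_eqF.
Qed.

(** For [j < n], the angles whose cosines are the roots of the [n]-th Chebyshev polynomial. *)
Definition cheb_node (n j : nat) : R := (j.*2.+1)%:R * (pi / (n.*2)%:R).

(** Telescoping: [2 sin t cos ((2j+1) t) = sin ((2j+2) t) - sin (2j t)]. *)
Lemma sum_cos_odd (n : nat) (t : R) :
  2 * sin t * \sum_(j < n) cos ((j.*2.+1)%:R * t) = sin ((n.*2)%:R * t).
Proof.
elim: n => [|n IH]; first by rewrite big_ord0 mul0r sin0 mulr0.
rewrite big_ord_recr /= mulrDr IH doubleS.
have -> : (n.*2)%:R * t = (n.*2.+1)%:R * t - t by rewrite -natr1; ring.
have -> : (n.*2.+2)%:R * t = (n.*2.+1)%:R * t + t by rewrite -natr1; ring.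
by rewrite sinB sinD; ring.
Qed.

Lemma sin_natr_pi (k : nat) : sin (k%:R * pi) = 0 :> R.
Proof.
elim: k => [|k IH]; first by rewrite mul0r sin0.
by rewrite -natr1 mulrDl mul1r sinDpi IH oppr0.
Qed.

(** In [sum_cos_odd] take [t = k pi / (2n)]: the right side is [sin (k pi) = 0], while [0 < t < pi]
    gives [sin t > 0]. *)
Lemma sum_cos_node (n k : nat) : (0 < k < n.*2)%N ->
  \sum_(j < n) cos (k%:R * cheb_node n j) = 0.
Proof.
move=> /andP[k0 kn].
have n0 : (0 < n.*2)%N by apply: leq_trans kn.
have n0' : 0 < (n.*2)%:R :> R by rewrite ltr0n.
pose t : R := k%:R * (pi / (n.*2)%:R).
have st : 0 < sin t.
  apply: sin_gt0_pi; rewrite /t; apply/andP; split.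
    by apply: mulr_gt0; [rewrite ltr0n | apply: divr_gt0 => //; exact: pi_gt0].
  by rewrite mulrCA gtr_pMr ?pi_gt0 // ltr_pdivrMr // mul1r ltr_nat.
have := sum_cos_odd n t.
have -> : (n.*2)%:R * t = k%:R * pi by rewrite /t; field; rewrite gt_eqF.
rewrite sin_natr_pi => /eqP; rewrite mulf_eq0 mulf_eq0 pnatr_eq0 (gt_eqF st) /=.
move=> /eqP h; rewrite -[RHS]h; apply: eq_bigr => j _; congr cos.
by rewrite /cheb_node /t; ring.
Qed.

(** Product-to-sum: [k + l] and, for [k != l], [|k - l|] lie strictly between 0 and [2n], so their
    cosine sums vanish; for [k = l] the difference contributes [n / 2]. *)
Lemma chebyshev_discrete_orthogonal (n k l : nat) :
  (k < n)%N -> (0 < l < n)%N ->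
  \sum_(j < n) cos (k%:R * cheb_node n j) * cos (l%:R * cheb_node n j)
  = if k == l then n%:R / 2 else 0.
Proof.
move=> kn /andP[l0 ln].
have cosM (a b : R) : cos a * cos b = (cos (a + b) + cos (a - b)) / 2.
  by rewrite cosD cosB; field.
under eq_bigr do rewrite cosM.
rewrite -mulr_suml big_split /=.
have -> : \sum_(j < n) cos (k%:R * cheb_node n j + l%:R * cheb_node n j) = 0.
  under eq_bigr do rewrite -mulrDl -natrD.
  by apply: sum_cos_node; rewrite addn_gt0 l0 orbT -addnn /= -addnS leq_add // ltnW.
rewrite add0r; case: ltngtP => [kl|lk|->].
- under eq_bigr do rewrite -cosN opprB -mulrBl -natrB 1?ltnW //.
  by rewrite sum_cos_node ?mul0r // subn_gt0 kl -addnn; lia.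
- under eq_bigr do rewrite -mulrBl -natrB 1?ltnW //.
  by rewrite sum_cos_node ?mul0r // subn_gt0 lk -addnn; lia.
under eq_bigr do rewrite subrr cos0.
by rewrite sumr_const card_ord.
Qed.

(* The discrete orthogonality bounds the Chebyshev coefficients of p by 2 B,
   and the derivative of the k-th Chebyshev polynomial at 0 is at most k. *)
Lemma markov_at0 (p : {poly R}) (n : nat) (B : R) : (size p <= n)%N ->
  (forall t, `|t| <= 1 -> `|p.[t]| <= B) -> `|p^`().[0]| <= 2 * n%:R ^+ 2 * B.
Proof.
move=> sp hB.
have B0 : 0 <= B by apply: le_trans (hB 0 _); rewrite ?normr0.
have [c pc] := poly_chebyshev_expansion sp.
have hc l : (0 < l < n)%N -> `|c l| <= 2 * B.
  move=> /andP[l0 ln]; have n0 : 0 < n%:R :> R by rewrite ltr0n; apply: leq_trans ln.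
  have E : \sum_(j < n) p.[cos (cheb_node n j)] * cos (l%:R * cheb_node n j)
         = c l * (n%:R / 2).
    transitivity (\sum_(j < n) \sum_(k < n)
        c k * (cos (k%:R * cheb_node n j) * cos (l%:R * cheb_node n j))).
      apply: eq_bigr => j _; rewrite pc horner_sum mulr_suml.
      by apply: eq_bigr => k _; rewrite hornerZ chebyshev_cos mulrA.
    rewrite exchange_big /= (bigD1 (Ordinal ln)) //= [X in _ + X]big1 ?addr0; last first.
      move=> k kl; rewrite -mulr_sumr chebyshev_discrete_orthogonal ?l0 //.
      by rewrite (negbTE (_ : (k : nat) != l)) ?mulr0.
    by rewrite -mulr_sumr chebyshev_discrete_orthogonal ?l0 // eqxx.
  have : `|c l * (n%:R / 2)| <= n%:R * B.
    rewrite -E; apply: (le_trans (ler_norm_sum _ _ _)).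
    rewrite mulr_natl -[in leRHS](card_ord n) -sumr_const; apply: ler_sum => j _.
    rewrite normrM -[leRHS]mulr1; apply: ler_pM => //.
      by apply: hB; rewrite ler_norml cos_geN1 cos_le1.
    by rewrite ler_norml cos_geN1 cos_le1.
  rewrite normrM [X in _ * X]ger0_norm ?divr_ge0 ?ler0n // => h.
  by rewrite -(ler_pM2r n0); lra.
rewrite pc raddf_sum horner_sum.
apply: (le_trans (ler_norm_sum _ _ _)).
apply: (@le_trans _ _ (\sum_(k < n) 2 * n%:R * B)); last first.
  by rewrite sumr_const card_ord -mulr_natr expr2; lra.
apply: ler_sum => -[[|k] kn] _.
  (* The coefficient of index 0 is not covered by [hc], but the zeroth Chebyshev polynomial is
     constant. *)
  rewrite /= derivZ hornerZ normrM.
  have := chebyshev_deriv0 0; rewrite normr_le0 => /eqP ->.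
  by rewrite normr0 mulr0 !mulr_ge0 ?ler0n.
rewrite /= derivZ hornerZ normrM mulrAC.
apply: ler_pM => //; first by apply: hc.
apply: (le_trans (chebyshev_deriv0 _)).
by rewrite ler_nat ltnW.
Qed.

End Chebyshev.

(** * Polynomial functions on lines *)

Section LineRestriction.
Variables (R : realType) (n : nat).
Implicit Types (p : mpoly.mpoly n R) (x : 'rV[R]_n) (i : 'I_n).

(** The restriction of [p] to the line through [x] in the [i]-th direction, kept as a formal
    polynomial so that its degree and derivatives are available. *)
Definition line_poly p x i : {poly R} :=
  mmap (@polyC R) (fun j => if j == i then 'X + (x ord0 j)%:P else (x ord0 j)%:P) p.

Lemma horner_line_poly p x i t :
  (line_poly p x i).[t] = poly_fun p (x + t *: delta_mx ord0 i).
Proof.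
rewrite /poly_fun mevalE /line_poly /mmap horner_sum; apply: eq_bigr => m _.
rewrite hornerM hornerC; congr (_ * _); rewrite /mmap1 horner_prod.
apply: eq_bigr => j _; rewrite horner_exp !mxE eqxx /=.
by case: eqP => _; rewrite !hornerE ?mulr1 ?mulr0 ?addr0 // addrC.
Qed.

Lemma horner_line_poly0 p x i : (line_poly p x i).[0] = poly_fun p x.
Proof. by rewrite horner_line_poly scale0r addr0. Qed.

Lemma line_poly_sum (I : Type) (s : seq I) (F : I -> mpoly.mpoly n R) x i :
  line_poly (\sum_(k <- s) F k) x i = \sum_(k <- s) line_poly (F k) x i.
Proof. exact: raddf_sum. Qed.

Lemma line_polyZ c p x i : line_poly (c *: p) x i = c *: line_poly p x i.
Proof. by rewrite /line_poly mmapZ mul_polyC. Qed.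

Lemma line_polyX m x i : line_poly (mpolyX R m) x i =
  (\prod_(j < n | j != i) x ord0 j ^+ m j) *: ('X + (x ord0 i)%:P) ^+ m i.
Proof.
rewrite /line_poly mmapX /mmap1 (bigD1 i) //= eqxx mulrC -mul_polyC rmorph_prod.
congr (_ * _); apply: eq_bigr => j /negbTE ->.
by rewrite rmorphXn.
Qed.

Lemma deriv_line_poly p x i : (line_poly p x i)^`() = line_poly (mderiv i p) x i.
Proof.
have -> : mderiv i p = \sum_(m <- msupp p) mcoeff m p *: mderiv i (mpolyX R m).
  by rewrite {1}(mpolyE p) raddf_sum; apply: eq_bigr => m _; rewrite /= mderivZ.
rewrite {1}(mpolyE p) !line_poly_sum raddf_sum.
apply: eq_bigr => m _; rewrite /= !line_polyZ derivZ; congr (_ *: _).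
rewrite mderivX line_polyZ !line_polyX derivZ deriv_exp derivD derivX derivC addr0 mul1r.
rewrite -scaler_nat !scalerA [X in _ = X *: _]mulrC.
congr (_ * _ *: _ ^+ _); last by rewrite mnmBE mnm1E eqxx subn1.
by apply: eq_bigr => j ji; rewrite mnmBE mnm1E eq_sym (negbTE ji) subn0.
Qed.

Lemma size_line_poly p x i : (size (line_poly p x i) <= msize p)%N.
Proof.
rewrite (mpolyE p) line_poly_sum -mpolyE; apply: (leq_trans (size_sum _ _ _)).
apply/bigmax_leqP_seq => m mp _; apply: leq_trans (msize_mdeg_lt mp).
rewrite line_polyZ line_polyX; apply: (leq_trans (size_scale_leq _ _)).
apply: (leq_trans (size_scale_leq _ _)).
rewrite -[(x ord0 i)%:P]opprK -polyCN size_exp_XsubC ltnS mdegE (bigD1 i) //=.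
exact: leq_addr.
Qed.

Lemma msize_mderiv p i k : (msize p <= k)%N -> (msize (mderiv i p) <= k)%N.
Proof.
move=> pk; rewrite msizeE; apply/bigmax_leqP_seq => m mp _.
have : mnm_add m (mnm1 i) \in msupp p.
  rewrite mcoeff_msupp; move: mp; rewrite mcoeff_msupp mcoeff_mderiv.
  by apply: contraNneq => ->; rewrite mul0rn.
move=> /msize_mdeg_lt h; apply: leq_trans pk; apply: leq_ltn_trans h.
by rewrite mdegD leq_addr.
Qed.

(** The mean value theorem is used twice, for [q] between 0 and [h], then for [q'] between 0 and the
    intermediate point; hence [M] rather than [M / 2]. *)
Lemma horner_taylor2 (q : {poly R}) (h M : R) :
  (forall t, `|t| <= `|h| -> `|q^`()^`().[t]| <= M) ->
  `|q.[h] - q.[0] - h * q^`().[0]| <= M * h ^+ 2.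
Proof.
move=> hM.
have mvt (r : {poly R}) (a : R) :
    exists2 c, `|c| <= `|a| & r.[a] - r.[0] = r^`().[c] * a.
  have [a0|a0] := leP 0 a.
    have [|c] := @MVT_segment R (horner r) (horner r^`()) 0 a a0.
      by apply: continuous_subspaceT; exact: continuous_horner.
    rewrite in_itv /= subr0 => /andP[c0 ca] E; exists c => //.
    by rewrite !ger0_norm.
  have [|c] := @MVT_segment R (horner r) (horner r^`()) a 0 (ltW a0).
    by apply: continuous_subspaceT; exact: continuous_horner.
  rewrite in_itv /= => /andP[ca c0] E; exists c.
    by rewrite !ler0_norm // ?lerN2 // ltW.
  by rewrite -[LHS]opprB E sub0r mulrN opprK.
have [c ch ->] := mvt q h.
have [c' c'h E] := mvt q^`() c.
rewrite mulrC -mulrBr E normrM normrM.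
have m0 : 0 <= M by apply: le_trans (hM 0 _); rewrite ?normr0.
have hc' := hM c' (le_trans c'h ch).
rewrite -[h ^+ 2]real_normK ?num_real // expr2 [leRHS]mulrCA.
by apply: ler_wpM2l => //; apply: ler_pM.
Qed.

Lemma poly_fun_derivable p x i :
  derivable (poly_fun p) x (delta_mx ord0 i) /\
  'D_(delta_mx ord0 i) (poly_fun p) x = poly_fun (mderiv i p) x.
Proof.
have := is_derive_poly (line_poly p x i) 0.
rewrite deriv_line_poly horner_line_poly0 => -[].
rewrite /derivable /derive.
have -> : (fun h : R => h^-1 *: ((horner (line_poly p x i) \o shift 0) (h *: 1)
    - (line_poly p x i).[0])) =
  (fun h : R => h^-1 *: ((poly_fun p \o shift x) (h *: delta_mx ord0 i)
    - poly_fun p x)).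
  apply/funext => h /=; rewrite horner_line_poly0 addr0 horner_line_poly.
  by rewrite [x + _]addrC [h%:A]mulr1.
by move=> h1 h2; split.
Qed.

Lemma continuous_poly_fun p : continuous (poly_fun p).
Proof.
rewrite (_ : poly_fun p = fun x => \sum_(m <- msupp p)
    mcoeff m p * \prod_(j < n) x ord0 j ^+ m j); last first.
  by apply/funext => x; rewrite /poly_fun mevalE.
have addc : continuous (fun z : R * R => z.1 + z.2).
  by move=> z; apply: cvgD; [exact: cvg_fst | exact: cvg_snd].
have mulc : continuous (fun z : R * R => z.1 * z.2).
  by move=> z; apply: cvgM; [exact: cvg_fst | exact: cvg_snd].
apply: (continuous_big addc) => m _.
move=> x; apply: continuousM; first exact: cst_continuous.
apply: (continuous_big mulc) => j _ y.
apply: (@continuous_comp _ _ _ (fun z : 'rV[R]_n => z ord0 j) (fun r => r ^+ m j)).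
  exact: coord_continuous.
exact: exprn_continuous.
Qed.

End LineRestriction.

Lemma laplacian_poly_fun (R : realType) (d : nat) (p : mpoly.mpoly d.+1 R) x :
  laplacian (poly_fun p) x = \sum_(i < d.+1) poly_fun (mderiv i (mderiv i p)) x.
Proof.
rewrite /laplacian; apply: eq_bigr => i _.
have -> : partial i (poly_fun p) = poly_fun (mderiv i p).
  by apply/funext => y; have [_] := poly_fun_derivable p y i.
by have [_] := poly_fun_derivable (mderiv i p) x i.
Qed.


(** * Euclidean norm and geometric series *)

Section EuclideanNorm.
Variables (R : realType) (n : nat).
Implicit Types x : 'rV[R]_n.

Lemma sumsq_ge0 x : 0 <= \sum_(i < n) x ord0 i ^+ 2.
Proof. by apply: sumr_ge0 => i _; apply: sqr_ge0. Qed.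

Lemma euclidean_norm_ge0 x : 0 <= euclidean_norm x.
Proof. exact: sqrtr_ge0. Qed.

Lemma sqr_euclidean_norm x : euclidean_norm x ^+ 2 = \sum_(i < n) x ord0 i ^+ 2.
Proof. exact/sqr_sqrtr/sumsq_ge0. Qed.

Lemma coord_le_euclidean_norm x i : `|x ord0 i| <= euclidean_norm x.
Proof.
rewrite -(@ler_pXn2r _ 2) ?nnegrE ?euclidean_norm_ge0 //.
rewrite sqr_euclidean_norm real_normK ?num_real // (bigD1 i) //= lerDl.
by apply: sumr_ge0 => j _; apply: sqr_ge0.
Qed.

Lemma euclidean_normZ (c : R) x : euclidean_norm (c *: x) = `|c| * euclidean_norm x.
Proof.
rewrite /euclidean_norm -sqrtr_sqr -sqrtrM ?sqr_ge0 //; congr Num.sqrt.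
by rewrite mulr_sumr; apply: eq_bigr => i _; rewrite mxE exprMn.
Qed.

Lemma euclidean_norm_delta i : euclidean_norm (delta_mx ord0 i : 'rV[R]_n) = 1.
Proof.
rewrite /euclidean_norm (bigD1 i) //= big1 ?mxE ?eqxx ?expr1n ?addr0 ?sqrtr1 //.
by move=> j /negbTE ji; rewrite mxE ji andbF expr0n.
Qed.

(** The triangle inequality along a coordinate axis: after squaring, Cauchy-Schwarz is just
    [|x_i| <= |x|]. *)
Lemma euclidean_norm_line x (t : R) i :
  euclidean_norm (x + t *: delta_mx ord0 i) <= euclidean_norm x + `|t|.
Proof.
have s0 := euclidean_norm_ge0 x.
rewrite -(@ler_pXn2r _ 2) ?nnegrE ?addr_ge0 ?euclidean_norm_ge0 //.
rewrite sqr_euclidean_norm sqrrD sqr_euclidean_norm real_normK ?num_real //.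
rewrite (bigD1 i) //= [in leRHS](bigD1 i) //= !mxE !eqxx /= mulr1.
have -> : \sum_(j < n | j != i) (x + t *: delta_mx ord0 i) ord0 j ^+ 2
    = \sum_(j < n | j != i) x ord0 j ^+ 2.
  by apply: eq_bigr => j /negbTE ji; rewrite !mxE ji andbF mulr0 addr0.
have : x ord0 i * t <= euclidean_norm x * `|t|.
  apply: (le_trans (ler_norm _)); rewrite normrM.
  by apply: ler_wpM2r => //; exact: coord_le_euclidean_norm.
by rewrite sqrrD !mulr2n; lra.
Qed.

Lemma continuous_euclidean_norm : continuous (@euclidean_norm R n).
Proof.
pose p : mpoly.mpoly n R := \sum_(i < n) (mpolyX R (mnm1 i)) ^+ 2.
have -> : @euclidean_norm R n = (fun r => Num.sqrt r) \o poly_fun p.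
  apply/funext => x; rewrite /euclidean_norm /= /poly_fun raddf_sum /=.
  by congr Num.sqrt; apply: eq_bigr => i _; rewrite rmorphXn /= mevalXU.
move=> x; apply: continuous_comp; first exact: continuous_poly_fun.
exact: sqrt_continuous.
Qed.

Lemma sphere_direction (i0 : 'I_n) x :
  exists2 y, unit_sphere y & x = euclidean_norm x *: y.
Proof.
have [x0|x0] := eqVneq (euclidean_norm x) 0.
  exists (delta_mx ord0 i0); first by rewrite /unit_sphere /= euclidean_norm_delta.
  rewrite x0 scale0r; apply/rowP => i; rewrite [RHS]mxE; apply/eqP.
  by rewrite -normr_le0 -x0 coord_le_euclidean_norm.
exists ((euclidean_norm x)^-1 *: x); last by rewrite scalerA divff ?scale1r.
rewrite /unit_sphere /= euclidean_normZ ger0_norm ?invr_ge0 ?euclidean_norm_ge0 //.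
by rewrite mulVf.
Qed.

End EuclideanNorm.

Section GeometricSeries.
Variable R : realType.
Implicit Types (f : nat -> R) (K th : R).

Lemma geometric_tail_le th (N M : nat) : 0 <= th -> th < 1 ->
  (1 - th) * \sum_(N <= k < M) th ^+ k <= th ^+ N.
Proof.
move=> t0 t1; have [NM|MN] := leqP N M; last first.
  by rewrite big_geq ?mulr0 ?exprn_ge0 // ltnW.
suff -> : (1 - th) * \sum_(N <= k < M) th ^+ k = th ^+ N - th ^+ M.
  by rewrite gerBl exprn_ge0.
rewrite mulr_sumr -[RHS]opprB -(telescope_sumr (fun k => th ^+ k) NM) -sumrN.
by apply: eq_bigr => k _; rewrite exprS; ring.
Qed.

Lemma series_geometric_bound f K th : 0 <= th -> th < 1 ->
  (forall m, `|f m| <= K * th ^+ m) ->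
  cvgn (series f) /\
  forall N, `|limn (series f) - series f N| <= K / (1 - th) * th ^+ N.
Proof.
move=> t0 t1 hf.
have K0 : 0 <= K by have := hf 0%N; rewrite expr0 mulr1; apply: le_trans.
have cf : cvgn (series f).
  apply/normed_cvg/(series_le_cvg _ _ hf) => // [m|]; first by rewrite mulr_ge0 ?exprn_ge0.
  by apply: is_cvg_geometric_series; rewrite ger0_norm.
split=> // N.
have cd : (fun M => `|series f M - series f N|) @ \oo --> `|limn (series f) - series f N|.
  by apply: cvg_norm; apply: cvgB => //; exact: cvg_cst.
rewrite -(cvg_lim _ cd) //; apply: limr_le; first by apply/cvg_ex; eexists; exact: cd.
near=> M.
have NM : (N <= M)%N by near: M; exists N.
rewrite /= sub_series_geq //; apply: (le_trans (ler_norm_sum _ _ _)).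
apply: (@le_trans _ _ (\sum_(N <= k < M) K * th ^+ k)).
  by apply: ler_sum => k _; exact: hf.
rewrite -mulr_sumr -mulrA; apply: ler_wpM2l => //.
rewrite mulrC ler_pdivlMr ?subr_gt0 // mulrC; exact: geometric_tail_le.
Unshelve. all: by end_near. Qed.

(** This absorbs the quadratic Markov factor into a larger ratio: by Bernoulli
    [(m+1) e <= (1 + e)^m], and [e = (1 - th) / 3] keeps [th (1 + e)^2 <= th (2 - th) < 1]. *)
Lemma sqr_geometric th : 0 <= th -> th < 1 -> exists K th' : R,
  [/\ 0 <= K, 0 <= th', th' < 1 & forall m, m.+1%:R ^+ 2 * th ^+ m <= K * th' ^+ m].
Proof.
move=> t0 t1; pose e := (1 - th) / 3.
have e0 : 0 < e by rewrite /e; lra.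
have e1 : e <= 1 by rewrite /e; lra.
exists (e ^- 2), (th * (1 + e) ^+ 2); split.
- by rewrite invr_ge0 exprn_ge0 // ltW.
- by rewrite mulr_ge0 // exprn_ge0; lra.
- have : (1 + e) ^+ 2 <= 1 + (1 - th) by rewrite /e; nra.
  by nra.
move=> m; rewrite [(th * _) ^+ m]exprMn exprAC [leRHS]mulrCA mulrC.
apply: ler_wpM2l; first exact: exprn_ge0.
rewrite -exprVn -exprMn; apply: lerXn2r; rewrite ?nnegrE ?mulr_ge0 ?exprn_ge0 ?invr_ge0 //; try lra.
rewrite mulrC ler_pdivlMr //.
have := bernoulli m (ltW e0).
by rewrite -natr1; nra.
Qed.

End GeometricSeries.

Lemma derivable_of_quadratic (R : realType) (n : nat) (f : 'rV[R]_n -> R)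
    (a v : 'rV[R]_n) (l C del : R) : 0 < del ->
  (forall h, `|h| < del -> `|f (a + h *: v) - f a - h * l| <= C * h ^+ 2) ->
  derivable f a v /\ 'D_v f a = l.
Proof.
move=> d0 hf.
suff H : h^-1 *: ((f \o shift a) (h *: v) - f a) @[h --> 0^'] --> l.
  by split; [apply/cvg_ex; exists l | exact/cvg_lim].
apply/cvgrPdist_le => e e0.
have C0 : 0 <= C.
  have := hf (del / 2); rewrite gtr0_norm ?divr_gt0 // => /(_ ltac:(lra)) h.
  have := le_trans (normr_ge0 _) h; rewrite pmulr_lge0 // exprn_gt0 //.
  by rewrite divr_gt0.
near=> h.
have h0 : h != 0 by near: h; exact: nbhs_dnbhs_neq.
have hd : `|h| < del by near: h; exact: dnbhs0_lt.
have he : `|h| < e / (C + 1) by near: h; apply: dnbhs0_lt; rewrite divr_gt0 //; lra.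
have hp : 0 < `|h| by rewrite normr_gt0.
rewrite /= [h *: v + a]addrC.
have -> : l - h^-1 *: (f (a + h *: v) - f a)
  = - (h^-1 * (f (a + h *: v) - f a - h * l)).
  by rewrite /GRing.scale /=; field.
rewrite normrN normrM normfV mulrC ler_pdivrMr //.
apply: (le_trans (hf _ hd)); rewrite -[h ^+ 2]real_normK ?num_real // expr2 mulrA.
apply: ler_wpM2r; first exact: ltW.
move: he; rewrite ltr_pdivlMr; last lra.
by nra.
Unshelve. all: by end_near. Qed.

(** * Nets for polynomials on the sphere *)

(* A near-maximizer of the determinant over r-tuples of points of a spanning
   family gives, by Cramer's rule, coordinates bounded by 2 (Auerbach). *)
Lemma auerbach (R : realType) (T : Type) (D : nat) (F : T -> 'rV[R]_D) (M : R) :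
  (forall x i, `|F x ord0 i| <= M) ->
  exists2 s : seq T, (size s <= D)%N &
    forall (c : 'cV[R]_D) (B : R), 0 <= B ->
      (forall i, (i < size s)%N -> forall x0,
          `|(F (nth x0 s i) *m c) ord0 ord0| <= B) ->
      forall x, `|(F x *m c) ord0 ord0| <= 2 * D%:R * B.
Proof.
move=> hM.
(* The maximal [r] is the largest number of points with linearly independent images; by maximality
   these images span every [F x]. *)
pose Q r := `[< exists z : 'I_r -> T, row_free (\matrix_(j < r) F (z j)) >].
have Q0 : exists r, Q r.
  have z : 'I_0 -> T by case.
  exists 0%N; apply/asboolP; exists z.
  by rewrite /row_free -leqn0 rank_leq_row.
have QD r : Q r -> (r <= D)%N.
  by move=> /asboolP[z]; rewrite /row_free => /eqP {1}<-; apply: rank_leq_col.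
have [r /asboolP[z0 hz0] maxr] := ex_maxnP Q0 QD.
set A0 := \matrix_(j < r) F (z0 j) in hz0.
have span x : (F x <= A0)%MS.
  apply: contraT => nx; suff : Q r.+1 by move/maxr; rewrite ltnn.
  apply/asboolP; exists (fun j => oapp z0 x (unlift ord0 j)).
  set A1 := (X in row_free X).
  have E : A1 = col_mx (F x) A0   :> 'M[R]_(1 + r, D).
    apply/matrixP => i j; rewrite !mxE; case: splitP => k ik.
      have -> : i = ord0 by apply: val_inj; rewrite /= ik ord1.
      by rewrite unlift_none /= ord1.
    have -> : i = lift ord0 k by apply: val_inj; rewrite /= ik.
    by rewrite liftK /= mxE.
  have Ex : F x != 0 by apply: contraNneq nx => ->; apply: sub0mx.
  rewrite /row_free E; apply/eqP.
  have := mxrank_sum_cap (F x) A0.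
  have -> : \rank (F x :&: A0)%MS = 0%N.
    apply/eqP; rewrite mxrank_eq0; apply/eqP.
    have := capmxSl (F x) A0; set W := (_ :&: _)%MS => WF.
    apply/eqP; apply: contraNT nx => W0.
    have rW : (0 < \rank W)%N by rewrite lt0n mxrank_eq0.
    have : (F x <= W)%MS.
      rewrite -(geq_leqif (mxrank_leqif_sup WF)).
      by rewrite (leq_trans _ rW) // rank_leq_row.
    by move=> /submx_trans; apply; apply: capmxSr.
  rewrite addn0 addsmxE => ->.
  by rewrite (eqP hz0) rank_rV Ex.
(* Coordinates in the basis [A0]; they are bounded because [F] is, so the determinants below have a
   finite supremum. *)
pose cc x : 'rV[R]_r := F x *m pinvmx A0.
have ccK x : cc x *m A0 = F x by rewrite mulmxKpV.
have [M' hM'] : exists M' : R, forall x i, `|cc x ord0 i| <= M'.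
  exists (\sum_(i < r) \sum_(j < D) M * `|pinvmx A0 j i|) => x i.
  rewrite mxE; apply: (le_trans (ler_norm_sum _ _ _)).
  rewrite [leRHS](bigD1 i) //= -[leLHS]addr0; apply: lerD.
    by apply: ler_sum => j _; rewrite normrM; apply: ler_wpM2r.
  apply: sumr_ge0 => k _; apply: sumr_ge0 => j _; apply: mulr_ge0 => //.
  exact: le_trans (hM x j).
pose Cz (z : 'I_r -> T) := \matrix_(j < r) cc (z j).
pose dets := range (fun z => `|\det (Cz z)|).
have dz0 : Cz z0 = 1%:M.
  apply: (row_free_inj hz0); rewrite mul1mx; apply/row_matrixP => j.
  by rewrite row_mul !rowK ccK.
have hs : has_sup dets.
  split; first by exists `|\det (Cz z0)|, z0.
  exists (\sum_(s : 'S_r) \prod_(i < r) M') => _ [z _ <-].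
  apply: (le_trans (ler_norm_sum _ _ _)); apply: ler_sum => s _.
  rewrite normrM normrX normrN1 expr1n mul1r normr_prod.
  by apply: ler_prod => i _; rewrite normr_ge0 /= mxE.
have s1 : 1 <= sup dets.
  apply: (ub_le_sup (proj2 hs)); exists z0 => //.
  by rewrite dz0 det1 normr1.
(* The supremum need not be attained, as [T] carries no topology; a tuple within a factor 2 of it
   exists because it is positive. *)
have [_ [z _ <-] hz] := @sup_adherent _ dets (sup dets / 2) ltac:(lra) hs.
have dz : 0 < `|\det (Cz z)| by lra.
exists [seq z i | i <- enum 'I_r].
  by rewrite size_map size_enum_ord; apply: QD; apply/asboolP; exists z0.
move=> c B B0 hB x.
have uz : Cz z \in unitmx by rewrite unitmxE unitfE -normr_gt0.
pose t := cc x *m invmx (Cz z).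
have tx : F x = t *m \matrix_(j < r) F (z j).
  have <- : Cz z *m A0 = \matrix_(j < r) F (z j).
    by apply/row_matrixP => j; rewrite row_mul !rowK ccK.
  by rewrite mulmxA mulmxKV // ccK.
have ht j : `|t ord0 j| <= 2.
  (* Cramer's rule: putting [x] in place of the [j]-th point multiplies the determinant by [t_j],
     and the result is at most [sup dets], which is less than twice the chosen determinant. *)
  pose zj k := if k == j then x else z k.
  have E : t ord0 j * \det (Cz z) = \det (Cz zj).
    rewrite /t /invmx uz -scalemxAr mxE mulrAC mulVf; last by rewrite -normr_gt0.
    rewrite mul1r (expand_det_row _ j) mxE; apply: eq_bigr => k _.
    rewrite [Cz zj j k]mxE /zj eqxx mxE; congr (_ * _).
    rewrite mxE /cofactor; congr (_ * \det _); apply/matrixP => a b.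
    by rewrite !mxE eq_sym (negbTE (neq_lift _ _)).
  have : `|\det (Cz zj)| <= sup dets by apply: (ub_le_sup (proj2 hs)); exists zj.
  rewrite -E normrM; move: hz dz; set a := `|t ord0 j|; set b := `|\det _|.
  by move=> ? ? ?; have a0 : 0 <= a := normr_ge0 _; nra.
rewrite tx -mulmxA mxE; apply: (le_trans (ler_norm_sum _ _ _)).
apply: (@le_trans _ _ (\sum_(j < r) 2 * B)); last first.
  rewrite sumr_const card_ord -mulr_natr.
  have rD : r%:R <= D%:R :> R by rewrite ler_nat; apply: QD; apply/asboolP; exists z0.
  by nra.
apply: ler_sum => j _; rewrite normrM; apply: ler_pM => //.
have := hB j; rewrite size_map size_enum_ord => /(_ (ltn_ord j) x).
rewrite (nth_map j) ?size_enum_ord // nth_ord_enum.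
congr (_ <= _); congr (`|_|); rewrite !mxE; apply: eq_bigr => k _.
by rewrite !mxE.
Qed.

Lemma card_bmultinom (n k : nat) : (#|{: bmultinom n k}| <= k ^ n)%N.
Proof.
have lt_k (m : bmultinom n k) i : (bmnm m i < k)%N.
  apply: leq_ltn_trans (bmdeg m); rewrite mdegE (bigD1 i) //=.
  exact: leq_addr.
pose f m : {ffun 'I_n -> 'I_k} := [ffun i => Ordinal (lt_k m i)].
have fI : injective f.
  move=> m1 m2 /ffunP e; apply/val_inj/mnmP => i.
  by have := e i; rewrite !ffunE => /(congr1 val).
by rewrite (leq_trans (leq_card f fI)) // card_ffun !card_ord.
Qed.

Lemma msize_exp (R : realType) (n N k : nat) (p : mpoly.mpoly n R) :
  (msize p <= N.+1)%N -> (msize (p ^+ k) <= (N * k).+1)%N.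
Proof.
move=> sp; elim: k => [|k IH]; first by rewrite expr0 muln0 msize1.
have [->|p0] := eqVneq p 0; first by rewrite expr0n msize0.
rewrite exprS msizeM ?expf_neq0 // mulnS.
by move: sp IH; set a := msize p; set b := msize _; lia.
Qed.

Lemma poly_funX (R : realType) (n k : nat) (p : mpoly.mpoly n R) x :
  poly_fun (p ^+ k) x = poly_fun p x ^+ k.
Proof. by rewrite /poly_fun rmorphXn. Qed.

(* Polynomials of degree at most N on the sphere span a space of dimension
   at most (N + 1) ^ n, so auerbach loses a factor polynomial in N; applied to
   the N-th power of p, and after taking N-th roots, the loss is bounded. *)
Lemma sphere_net (R : realType) (n N : nat) : (0 < N)%N ->
  exists s : seq 'rV[R]_n,
    [/\ (size s <= (N ^ 2).+1 ^ n)%N, forall y, y \in s -> unit_sphere y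
      & forall (p : mpoly.mpoly n R) (B : R), 0 <= B -> (msize p <= N.+1)%N ->
        (forall y, y \in s -> `|poly_fun p y| <= B) ->
        forall x, unit_sphere x -> `|poly_fun p x| <= 2 * 4 ^+ n * B].
Proof.
(* The [N]-th power of a polynomial of degree at most [N] has degree at most [N^2], hence below
   [k]. *)
move=> N0; pose k := (N ^ 2).+1.
pose T := {x : 'rV[R]_n | `[< unit_sphere x >]}.
have T1 (x : T) : unit_sphere (sval x) by exact: asboolW (svalP x).
pose F (x : T) : 'rV[R]_#|{: bmultinom n k}| :=
  \row_i \prod_(j < n) (sval x) ord0 j ^+ (bmnm (enum_val i) j).
have hF x i : `|F x ord0 i| <= 1.
  rewrite mxE normr_prod; apply: prodr_ile1 => j _.
  rewrite normr_ge0 normrX exprn_ile1 //.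
  by apply: (le_trans (coord_le_euclidean_norm _ _)); rewrite (T1 x).
have [s ss hs] := auerbach hF.
exists [seq sval x | x <- s]; split.
- by rewrite size_map (leq_trans ss) // card_bmultinom.
- by move=> _ /mapP[x _ ->]; exact: T1.
move=> p B B0 sp hp x sx.
have sq : (msize (p ^+ N) <= k)%N.
  by apply: leq_trans (msize_exp N sp) _; rewrite mulnn.
pose c : 'cV[R]_#|{: bmultinom n k}| := \col_i mcoeff (bmnm (enum_val i)) (p ^+ N).
have E y : (F y *m c) ord0 ord0 = poly_fun p (sval y) ^+ N.
  rewrite -poly_funX /poly_fun [in RHS](mpolywE sq) raddf_sum /= mxE.
  rewrite (reindex_omap (@enum_val _ (mem {: bmultinom n k}))
    (fun m => Some (enum_rank m))) /=; last first.
    by move=> m _; rewrite enum_rankK.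
  apply: eq_big => [i|i _]; first by rewrite enum_valK eqxx.
  by rewrite !mxE mevalZ mevalX mulrC.
have := hs c (B ^+ N) (exprn_ge0 _ B0) _ (exist _ x (asboolT sx)).
rewrite E /= normrX => h.
have K0 : 0 <= 2 * 4 ^+ n * B by rewrite !mulr_ge0 ?exprn_ge0.
rewrite -(@ler_pXn2r _ N) ?nnegrE //; apply: (le_trans (h _)).
  move=> i hi x0; rewrite E normrX; apply: lerXn2r; rewrite ?nnegrE //.
  by apply: hp; apply: map_f; apply: mem_nth.
rewrite exprMn; apply: ler_wpM2r; first exact: exprn_ge0.
rewrite -!natrX -!natrM -natrX ler_nat.
(* Since [N^2 + 1 <= 4^N], the loss is at most [2 * 4^(N n) <= (2 * 4^n)^N], whose [N]-th root is
   the stated constant. *)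
have c1 : (#|{: bmultinom n k}| <= (4 ^ N) ^ n)%N.
  apply: (leq_trans (card_bmultinom _ _)); case: (n) => // n'.
  rewrite leq_exp2r // /k; elim: (N) N0 => // -[//|m] IH _.
  by have := IH isT; rewrite !expnS expn0; nia.
apply: leq_trans (leq_mul (leqnn 2) c1) _.
rewrite expnMn -!expnM (mulnC N n) leq_mul2r; apply/orP; right.
by rewrite -{1}[2%N]expn1 leq_exp2l.
Qed.

(** * Tails of subnormal sums *)

Section Independence.
Import HBNNSimple.
Context (disp : measure_display) (T : measurableType disp) (R : realType).
Variable P : probability T R.
Local Open Scope ereal_scope.

Lemma measurable_preimage_RV (X : {RV P >-> R}) (B : set R) :
  measurable B -> measurable (X @^-1` B).
Proof. by move=> mB; rewrite -[_ @^-1` _]setTI; exact: measurable_funPT. Qed.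

Lemma nnsfun_sum_indic (f : {nnsfun R >-> R}) :
  exists (n : nat) (a : 'I_n -> R) (B : 'I_n -> set R),
    [/\ forall i, (0 <= a i)%R, forall i, measurable (B i)
      & forall x, f x = (\sum_(i < n) a i * \1_(B i) x)%R].
Proof.
pose s := fset_set (range f).
exists (size (enum_fset s)), (fun i => (nth 0 (enum_fset s) i)%R),
  (fun i => f @^-1` [set (nth 0 (enum_fset s) i)%R]).
split=> [i|i|x]; last exact: fimfunEord.
- have : (nth 0 (enum_fset s) i)%R \in s by apply: mem_nth.
  by rewrite in_fset_set // => /set_mem [x _ <-].
- have mf := @measurable_funPTI _ _ _ _ f.
  by apply: mf; exact: measurable_set1.
Qed.

(** From indicators to simple functions by linearity, then to [g] by monotone convergence. The
    weight [W] is meant to hold all the other factors of a product. *)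
Lemma integral_mul_indep (W : T -> R) (X : {RV P >-> R}) (c : R) (g : R -> R) :
  measurable_fun setT W -> (forall w, 0 <= W w)%R -> (0 <= c)%R ->
  measurable_fun setT g -> (forall x, 0 <= g x)%R ->
  (forall B : set R, measurable B ->
     \int[P]_w (W w * \1_B (X w))%:E <= c%:E * P (X @^-1` B)) ->
  \int[P]_w (W w * g (X w))%:E <= c%:E * \int[P]_w (g (X w))%:E.
Proof.
move=> mW W0 c0 mg g0 hB.
have mX : measurable_fun setT X by exact: measurable_funPT.
have mgE : measurable_fun [set: R] (fun x => (g x)%:E).
  by apply/measurable_EFinP.
pose f := nnsfun_approx measurableT mgE.
have f_nd := nd_nnsfun_approx measurableT mgE.
have f_cvg x : (f k x)%:E @[k --> \oo] --> (g x)%:E.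
  by apply: (cvg_nnsfun_approx measurableT mgE) => // y _; rewrite lee_fin.
have mf k : measurable_fun setT (fun w => f k (X w)).
  by apply: measurableT_comp => //; exact: measurable_funPT.
have fg k x : (f k x <= g x)%R.
  have nd : nondecreasing_seq (fun k => (f k x)%:E).
    by move=> a b ab; rewrite lee_fin; exact/lefP/f_nd.
  rewrite -lee_fin (cvg_unique _ (f_cvg x) (ereal_nondecreasing_cvgn nd)) //.
  by apply: ereal_sup_ubound; exists k.
have mWf k : measurable_fun setT (fun w => (W w * f k (X w))%:E).
  by apply/measurable_EFinP/measurable_funM.
have WfE w : limn (fun k => (W w * f k (X w))%:E) = (W w * g (X w))%:E.
  apply/cvg_lim => //; under eq_fun do rewrite EFinM; rewrite EFinM.
  exact: cvgeZl.
under eq_integral do rewrite -WfE.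
have nd_int : nondecreasing_seq (fun k => \int[P]_w (W w * f k (X w))%:E).
  move=> a b ab; apply: ge0_le_integral => //.
  - by move=> w _; rewrite lee_fin mulr_ge0.
  - by move=> w _; rewrite lee_fin ler_wpM2l //; exact/lefP/f_nd.
rewrite monotone_convergence //; last 2 first.
- by move=> k w _; rewrite lee_fin mulr_ge0.
- by move=> w _ a b ab; rewrite lee_fin ler_wpM2l //; exact/lefP/f_nd.
apply: lime_le; first exact: ereal_nondecreasing_is_cvgn.
apply: nearW => k.
have [n [a [B [a0 mB fE]]]] := nnsfun_sum_indic (f k).
have mI i : measurable_fun setT (fun w => \1_(B i) (X w) : R).
  by apply: measurableT_comp => //; exact: measurable_indic.
have aE w : (f k (X w))%:E = \sum_(i < n) (a i * \1_(B i) (X w))%:E.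
  by rewrite fE sumEFin.
apply: (@le_trans _ _ (\sum_(i < n) (a i)%:E * \int[P]_w (W w * \1_(B i) (X w))%:E)).
  under eq_integral => w _.
    rewrite fE mulr_sumr -sumEFin.
    under eq_bigr do rewrite mulrCA EFinM.
    over.
  rewrite ge0_integral_sum //; last 2 first.
  - move=> i; apply: emeasurable_funM => //; apply/measurable_EFinP.
    exact: measurable_funM.
  - by move=> i w _; apply: mule_ge0; rewrite lee_fin // mulr_ge0.
  apply: lee_sum => i _; rewrite ge0_integralZl //.
  - by apply/measurable_EFinP/measurable_funM.
  - by move=> w _; rewrite lee_fin mulr_ge0.
  - by rewrite lee_fin.
apply: (@le_trans _ _ (\sum_(i < n) (a i)%:E * (c%:E * P (X @^-1` (B i))))).
  by apply: lee_sum => i _; apply: lee_wpmul2l; [rewrite lee_fin | exact: hB].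
have -> : \sum_(i < n) (a i)%:E * (c%:E * P (X @^-1` (B i)))
    = c%:E * \int[P]_w (f k (X w))%:E.
  under eq_integral do rewrite aE.
  rewrite ge0_integral_sum //; last 2 first.
  - by move=> i; apply/measurable_EFinP/measurable_funM.
  - by move=> i w _; rewrite lee_fin mulr_ge0.
  rewrite ge0_sume_distrr; last first.
    by move=> i _; apply: integral_ge0 => w _; rewrite lee_fin mulr_ge0.
  apply: eq_bigr => i _; rewrite muleCA; congr (_ * _).
  under eq_integral do rewrite EFinM.
  rewrite ge0_integralZl //; [|exact/measurable_EFinP|by rewrite lee_fin].
  congr (_ * _).
  rewrite -[X in P X]setIT -integral_indic //; last exact: measurable_preimage_RV.
apply: lee_wpmul2l; first by rewrite lee_fin.
apply: ge0_le_integral => //.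
- by move=> w _; rewrite lee_fin.
- exact/measurable_EFinP.
- by apply/measurable_EFinP; apply: measurableT_comp.
- by move=> w _; rewrite lee_fin.
Qed.

(* Starting from the product rule for indicators, the indicators are replaced
   by the functions g i one variable at a time. *)
Lemma integral_prod_indep (I : eqType) (X : I -> {RV P >-> R}) (g : I -> R -> R)
    (c : I -> R) (s : seq I) :
  mutually_independent P X ->
  (forall i, measurable_fun setT (g i)) -> (forall i x, 0 <= g i x)%R ->
  (forall i, \int[P]_w (g i (X i w))%:E <= (c i)%:E) ->
  uniq s ->
  \int[P]_w (\prod_(i <- s) g i (X i w))%:E <= (\prod_(i <- s) c i)%:E.
Proof.
move=> indep mg g0 hc.
have c0 i : (0 <= c i)%R.
  by rewrite -lee_fin (le_trans _ (hc i)) // integral_ge0 // => w _; rewrite lee_fin.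
have mX i : measurable_fun setT (X i) by exact: measurable_funPT.
have mind i B : measurable B -> measurable_fun setT (fun w => \1_B (X i w) : R).
  by move=> mB; apply: measurableT_comp => //; exact: measurable_indic.
suff H s1 s2 (B : I -> set R) : uniq (s1 ++ s2) -> (forall i, measurable (B i)) ->
    \int[P]_w (\prod_(i <- s1) g i (X i w) * \prod_(i <- s2) \1_(B i) (X i w))%:E
    <= (\prod_(i <- s1) c i)%:E * \prod_(i <- s2) P (X i @^-1` B i).
  move=> us; have := H s [::] (fun=> setT).
  rewrite cats0 => /(_ us (fun=> measurableT)).
  by rewrite big_nil mule1; under eq_integral do rewrite big_nil mulr1.
elim: s1 s2 B => [|i s1 IH] s2 B /= us mB.
  (* With no [g] left, the integrand is the indicator of an intersection, whose probability is the
     product by independence. *)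
  rewrite big_nil mul1e -indep //.
  rewrite -[X in P X]setIT -integral_indic //; last first.
    apply: fin_bigcap_measurable => [|k _]; first exact: finite_seq.
    exact: measurable_preimage_RV.
  under [leLHS]eq_integral do rewrite big_nil mul1r.
  rewrite le_eqVlt; apply/orP; left; apply/eqP; apply: eq_integral => w _.
  congr (_%:E); rewrite indicE; case: (boolP (w \in _)) => [|/negP] h.
    rewrite big_seq big1 // => j js; rewrite indicE mem_set //.
    by move: h => /set_mem; apply.
  apply/eqP; rewrite prodf_seq_eq0; apply: contra_notT h => /hasPn h.
  apply: mem_set => j /= js; have := h j js; rewrite indicE.
  by case: (boolP (_ \in _)) => [ /set_mem //|_]; rewrite ?eqxx.
move: us => /andP[nis us].
rewrite big_cons EFinM.
set W := fun w => (\prod_(j <- s1) g j (X j w) * \prod_(j <- s2) \1_(B j) (X j w))%R.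
under eq_integral => w _.
  rewrite big_cons -mulrA mulrC -/(W w); over.
have mp (J : eqType) (r : seq J) (h : J -> T -> R) :
    (forall j, measurable_fun setT (h j)) ->
    measurable_fun setT (fun w => \prod_(j <- r) h j w)%R.
  by move=> mh; apply: measurable_prod => j _; exact: mh.
have mW : measurable_fun setT W.
  apply: measurable_funM; apply: mp => j; last exact: mind.
  by apply: measurableT_comp.
have W0 w : (0 <= W w)%R.
  by rewrite /W mulr_ge0 // prodr_ge0 // => j _; rewrite indicE.
have pfin : \prod_(j <- s2) P (X j @^-1` B j) \is a fin_num.
  by apply: prode_fin_num => j _; rewrite fin_num_measure //; exact: measurable_preimage_RV.
have p0 : 0 <= \prod_(j <- s2) P (X j @^-1` B j) by apply: prode_ge0.
pose C := (\prod_(j <- s1) c j * fine (\prod_(j <- s2) P (X j @^-1` B j)))%R.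
have C0 : (0 <= C)%R by rewrite mulr_ge0 ?prodr_ge0 // fine_ge0.
have CE : C%:E = (\prod_(j <- s1) c j)%:E * \prod_(j <- s2) P (X j @^-1` B j).
  by rewrite EFinM fineK.
apply: (le_trans (integral_mul_indep mW W0 C0 (mg i) (g0 i) _)).
  (* Overwriting [B] at [i] changes no factor over [s2], as [i] is not in [s2]; the induction
     hypothesis is then used with [i :: s2] as the list of indicators. *)
  move=> A mA; pose B' j := if j == i then A else B j.
  have is2 j : j \in s2 -> B' j = B j.
    move=> js; rewrite /B'; case: eqP => // ji.
    by move: nis; rewrite mem_cat -ji js orbT.
  have := IH (i :: s2) B'; rewrite uniq_catC /= mem_cat orbC -mem_cat nis uniq_catC us.
  have mB' j : measurable (B' j) by rewrite /B'; case: ifP.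
  move=> /(_ isT mB'); rewrite big_cons {2}/B' eqxx.
  rewrite (eq_big_seq (fun j => P (X j @^-1` B j))); last by move=> j js; rewrite is2.
  rewrite CE -muleA [P _ * _]muleC; apply: le_trans.
  rewrite le_eqVlt; apply/orP; left; apply/eqP; apply: eq_integral => w _.
  rewrite big_cons {1}/B' eqxx /W -mulrA; congr (_ * _)%:E; rewrite mulrC; congr (_ * _)%R.
  by apply: eq_big_seq => j js; rewrite is2.
rewrite CE muleC muleA; apply: lee_wpmul2r => //.
by apply: lee_wpmul2r => //; rewrite lee_fin prodr_ge0.
Qed.

End Independence.

Section SubgaussianTail.
Context (disp : measure_display) (T : measurableType disp) (R : realType).
Variables (P : probability T R) (I : eqType) (X : I -> {RV P >-> R}).
Hypothesis indep : mutually_independent P X.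
Hypothesis subn : forall i, subnormal P (X i).

Lemma measurable_linear_comb (s : seq I) (c : I -> R) :
  measurable_fun setT (fun w => \sum_(i <- s) c i * X i w).
Proof.
by apply: measurable_sum => i; apply: measurable_funM => //; exact: measurable_funPT.
Qed.

Lemma subnormal_integral_le i (t : R) :
  (\int[P]_w (expR (t * X i w))%:E <= (expR (t ^+ 2 / 2))%:E)%E.
Proof.
have := subn i t; rewrite /mmt_gen_fun unlock /=.
by under eq_integral do rewrite mulrC.
Qed.

Lemma expR_sum (s : seq I) (F : I -> R) :
  expR (\sum_(i <- s) F i) = \prod_(i <- s) expR (F i).
Proof. by rewrite (big_morph _ (@expRD R) (@expR0 R)). Qed.

Lemma linear_comb_mgf (s : seq I) (c : I -> R) : uniq s ->
  (\int[P]_w (expR (\sum_(i <- s) c i * X i w))%:E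
     <= (expR (\sum_(i <- s) c i ^+ 2 / 2))%:E)%E.
Proof.
move=> us; under eq_integral do rewrite expR_sum.
rewrite expR_sum.
apply: (@integral_prod_indep _ _ _ _ _ _ (fun i x => expR (c i * x))) => //.
- by move=> i; apply: measurableT_comp => //; exact: measurable_funM.
- by move=> i; apply: subnormal_integral_le.
Qed.

Lemma measurable_tail (s : seq I) (c : I -> R) (a : R) :
  measurable [set w | a < \sum_(i <- s) c i * X i w].
Proof.
rewrite -[X in measurable X]setTI.
have := @measurable_linear_comb s c measurableT `]a, +oo[%classic (measurable_itv _).
congr (measurable (_ `&` _)); apply/seteqP.
by split=> w /=; rewrite in_itv /= andbT.
Qed.

Lemma one_sided_tail (s : seq I) (c : I -> R) (sg tau : R) : uniq s ->
  0 < sg -> 0 <= tau -> \sum_(i <- s) c i ^+ 2 <= sg ^+ 2 ->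
  (P [set w | (sg * tau < \sum_(i <- s) c i * X i w)%R]
     <= (expR (- (tau ^+ 2 / 2)))%:E)%E.
Proof.
move=> us sg0 tau0 hs; set A := [set w | _].
have mA : measurable A by exact: measurable_tail.
(* Chernoff's method: [l^2 sg^2 / 2 - l sg tau] is least at [l = tau / sg], with value
   [- tau^2 / 2]. *)
pose l := tau / sg.
have l0 : 0 <= l by rewrite divr_ge0 // ltW.
pose Z w := expR (\sum_(i <- s) l * c i * X i w).
have mZ : measurable_fun setT Z.
  apply: measurableT_comp => //; exact: (measurable_linear_comb s (fun i => l * c i)).
have hZ : (\int[P]_w (Z w)%:E <= (expR (tau ^+ 2 / 2))%:E)%E.
  apply: (le_trans (linear_comb_mgf (fun i => l * c i) us)).
  rewrite lee_fin ler_expR -mulr_suml; apply: ler_wpM2r => //.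
  under eq_bigr do rewrite exprMn; rewrite -mulr_sumr.
  apply: (le_trans (ler_wpM2l (sqr_ge0 l) hs)).
  by rewrite -exprMn /l mulfVK // gt_eqF.
rewrite -[A]setIT -integral_indic //.
apply: (@le_trans _ _ (\int[P]_w ((expR (- tau ^+ 2))%:E * (Z w)%:E))%E).
  apply: ge0_le_integral => //.
  - by apply/measurable_EFinP; exact: measurable_indic.
  - by apply: emeasurable_funM => //; exact/measurable_EFinP.
  move=> w _; rewrite -EFinM lee_fin indicE.
  case: (boolP (w \in A)) => [/set_mem Aw|_]; last by rewrite mulr_ge0 ?expR_ge0.
  rewrite -expRD -expR0 ler_expR addrC subr_ge0.
  under eq_bigr do rewrite -mulrA; rewrite -mulr_sumr.
  apply: le_trans (ler_wpM2l l0 (ltW Aw)).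
  by rewrite /l mulrA mulfVK ?gt_eqF.
rewrite ge0_integralZl //; last 2 first.
- exact/measurable_EFinP.
- by move=> w _; rewrite lee_fin expR_ge0.
apply: (le_trans (lee_wpmul2l _ hZ)); first by rewrite lee_fin expR_ge0.
rewrite -EFinM lee_fin -expRD ler_expR; lra.
Qed.

Lemma subgaussian_tail (s : seq I) (c : I -> R) (sg tau : R) : uniq s ->
  0 <= sg -> 0 <= tau -> \sum_(i <- s) c i ^+ 2 <= sg ^+ 2 ->
  (P [set w | (sg * tau < `|\sum_(i <- s) c i * X i w|)%R]
     <= (2 * expR (- (tau ^+ 2 / 2)))%:E)%E.
Proof.
move=> us sg0 tau0 hs.
(* For [sg = 0] the parameter [tau / sg] is meaningless, but then all coefficients on [s] vanish and
   the event is empty. *)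
move: sg0; rewrite le_eqVlt => /predU1P[sg0|sg0].
  rewrite [X in P X](_ : _ = set0).
    by rewrite measure0 lee_fin mulr_ge0 ?expR_ge0.
  apply/seteqP; split=> w //=; rewrite -sg0 mul0r normr_gt0 big_seq big1 ?eqxx //.
  move=> i si; have : c i ^+ 2 <= 0.
    apply: le_trans (_ : \sum_(i <- s) c i ^+ 2 <= _); last first.
      by rewrite (le_trans hs) // -sg0 expr0n.
    rewrite (big_rem i) //= lerDl; apply: sumr_ge0 => j _; exact: sqr_ge0.
  by rewrite exprn_even_le0 //= => /eqP ->; rewrite mul0r.
have := one_sided_tail us sg0 tau0 hs.
have := @one_sided_tail s (fun i => - c i) _ _ us sg0 tau0.
under eq_bigr do rewrite sqrrN.
move=> /(_ hs) h1 h2.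
rewrite mulr_natl mulr2n EFinD; apply: le_trans (leeD h1 h2).
rewrite [X in P X](_ : _ = [set w | sg * tau < \sum_(i <- s) - c i * X i w]
       `|` [set w | sg * tau < \sum_(i <- s) c i * X i w]); last first.
  apply/seteqP; split=> w /=; rewrite ltr_normr orbC;
    under [in - _]eq_bigr do rewrite -[c _]opprK mulNr;
    by rewrite sumrN opprK => /orP.
by apply: measureU2; exact: measurable_tail.
Qed.

End SubgaussianTail.

(** * Harmonic series of polynomials *)

Section PolynomialSeries.
Variables (R : realType) (n : nat).
Implicit Types (p : nat -> mpoly.mpoly n R) (x : 'rV[R]_n).

(** Strong enough for convergence in the open ball and stable under differentiation; the degree
    bound is what the Markov inequality uses. *)
Definition geometrically_bounded p : Prop :=
  (forall m, (msize (p m) <= m.+1)%N) /\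
  forall rho, rho < 1 -> exists K th : R,
    [/\ 0 <= th, th < 1 & forall m x, euclidean_norm x <= rho ->
        `|poly_fun (p m) x| <= K * th ^+ m].

Definition poly_series p x : R := limn (series (fun m => poly_fun (p m) x)).

(** Restrict to the segment of half-length [d] around [x], which stays in the ball of radius
    [rho + d < 1], and rescale it to [[-1, 1]]; [markov_at0] bounds the derivative at the centre. *)
Lemma geometrically_bounded_mderiv p i :
  geometrically_bounded p -> geometrically_bounded (fun m => mderiv i (p m)).
Proof.
move=> [sp hp]; split=> [m|rho rho1]; first exact: msize_mderiv.
pose d := (1 - rho) / 2.
have d0 : 0 < d by rewrite /d; lra.
have [|K [th [t0 t1 hK]]] := hp (rho + d); first by rewrite /d; lra.
have [K' [th' [K'0 t0' t1' hK']]] := sqr_geometric t0 t1.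
exists (2 * K / d * K'), th'; split=> // m x xrho.
have K0 : 0 <= K.
  have := hK 0%N x; rewrite expr0 mulr1 => hK0.
  by apply: (le_trans (normr_ge0 _) (hK0 _)); rewrite (le_trans xrho) // lerDl ltW.
pose q := line_poly (p m) x i \Po (d *: 'X).
have sq : (size q <= m.+1)%N.
  apply: (leq_trans (size_comp_poly_leq _ _)).
  have := leq_trans (size_line_poly (p m) x i) (sp m).
  have : (size (d *: 'X : {poly R}) <= 2)%N.
    by apply: leq_trans (size_scale_leq _ _) _; rewrite size_polyX.
  by move: (size _) (size _) => a b; nia.
have hq t : `|t| <= 1 -> `|q.[t]| <= K * th ^+ m.
  move=> t_1; rewrite horner_comp hornerZ hornerX horner_line_poly; apply: hK.
  apply: (le_trans (euclidean_norm_line _ _ _)); rewrite normrM gtr0_norm //.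
  by apply: lerD => //; rewrite ler_piMr // ltW.
have qE : q^`().[0] = poly_fun (mderiv i (p m)) x * d.
  rewrite /q deriv_comp derivZ derivX deriv_line_poly hornerM horner_comp.
  by rewrite !hornerZ hornerX mulr0 horner_line_poly0 -polyC1 hornerC mulr1.
have := markov_at0 sq hq; rewrite qE normrM (gtr0_norm d0).
rewrite -ler_pdivlMr // => /le_trans; apply.
have -> : 2 * m.+1%:R ^+ 2 * (K * th ^+ m) / d
  = 2 * K / d * (m.+1%:R ^+ 2 * th ^+ m) by field; rewrite gt_eqF.
rewrite -[leRHS]mulrA; apply: ler_wpM2l; last exact: hK'.
by apply: divr_ge0; [apply: mulr_ge0 | exact: ltW].
Qed.

Section Regularity.
(** Agreement of [f] with the series is asked inside the ball only, because the results are applied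
    again to partial derivatives, which are identified with series only there. *)
Variables (p : nat -> mpoly.mpoly n R) (f : 'rV[R]_n -> R).
Hypothesis hp : geometrically_bounded p.
Hypothesis fE : forall x, open_unit_ball x -> f x = poly_series p x.

Lemma poly_series_cvg x : open_unit_ball x ->
  cvgn (series (fun m => poly_fun (p m) x)).
Proof.
move=> x1; have [K [th [t0 t1 hK]]] := proj2 hp _ x1.
by have [] := series_geometric_bound t0 t1 (fun m => hK m x (lexx _)).
Qed.

(** A three-epsilon argument: on the ball of radius [rho], halfway between [|x|] and 1, the
    polynomial partial sums converge uniformly. *)
Lemma poly_series_continuous x : open_unit_ball x -> {for x, continuous f}.
Proof.
move=> x1; pose rho := (1 + euclidean_norm x) / 2.
have x1' : euclidean_norm x < 1 by exact: x1.
have rho1 : rho < 1 by rewrite /rho; lra.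
have xrho : euclidean_norm x < rho by rewrite /rho; lra.
have [K [th [t0 t1 hK]]] := proj2 hp _ rho1.
have tail y N : euclidean_norm y <= rho ->
    `|f y - poly_fun (\sum_(0 <= k < N) p k) y| <= K / (1 - th) * th ^+ N.
  move=> yrho; rewrite fE; last exact: le_lt_trans rho1.
  have [_ /(_ N)] := series_geometric_bound t0 t1 (fun m => hK m y yrho).
  congr (`| _ - _ | <= _); rewrite /series /= /poly_fun raddf_sum.
  exact: eq_bigr.
apply/(@cvgrPdist_le R R _ (nbhs x) (nbhs_filter x)) => e e0.
have [N hN] : exists N, K / (1 - th) * th ^+ N <= e / 3.
  have /cvgr0_norm_le/(_ (e / 3)) : geometric (K / (1 - th)) th @ \oo --> 0.
    by apply: cvg_geometric; rewrite ger0_norm.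
  move=> /(_ ltac:(lra))[N _ hN]; exists N.
  by apply: le_trans (hN N (leqnn _)); exact: ler_norm.
pose S y := poly_fun (\sum_(0 <= k < N) p k) y.
have near_rho : \forall y \near x, euclidean_norm y <= rho.
  by have /cvgr_le/(_ _ xrho) := @continuous_euclidean_norm R n x.
have near_S : \forall y \near x, `|S x - S y| <= e / 3.
  have /cvgr_dist_le/(_ (e / 3)) :=
    @continuous_poly_fun R n (\sum_(0 <= k < N) p k) x.
  by apply; lra.
near=> y.
have yrho : euclidean_norm y <= rho by near: y.
have : `|S x - S y| <= e / 3 by near: y.
have := tail x N (ltW xrho); have := tail y N yrho; rewrite -/(S x) -/(S y).
set a := S x; set b := S y => h1 h2 h3.
have -> : f x - f y = (f x - a) + (a - b) - (f y - b) by ring.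
apply: (le_trans (ler_normB _ _)).
have := ler_normD (f x - a) (a - b); lra.
Unshelve. all: by end_near. Qed.

(** The Taylor remainder of each term is at most [h^2] times a bound on its second derivative over a
    larger ball; these bounds are geometric in [m], so they sum to a quadratic remainder for [f]. *)
Lemma poly_series_derivable x i : open_unit_ball x ->
  derivable f x (delta_mx ord0 i) /\
  'D_(delta_mx ord0 i) f x = poly_series (fun m => mderiv i (p m)) x.
Proof.
move=> x1; pose d := (1 - euclidean_norm x) / 2.
have x1' : euclidean_norm x < 1 by exact: x1.
have d0 : 0 < d by rewrite /d; lra.
have hp1 := geometrically_bounded_mderiv i hp.
have hp2 := geometrically_bounded_mderiv i hp1.
have [|K [th [t0 t1 hK]]] := proj2 hp2 (euclidean_norm x + d).
  by rewrite /d; lra.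
apply: (@derivable_of_quadratic _ _ _ _ _ _ (K / (1 - th)) _ d0) => h hd.
pose y := x + h *: delta_mx ord0 i.
have y1 : open_unit_ball y.
  apply: le_lt_trans (euclidean_norm_line _ _ _) _.
  by move: hd; rewrite /d; lra.
pose D m := poly_fun (p m) y - poly_fun (p m) x - h * poly_fun (mderiv i (p m)) x.
have hD m : `|D m| <= K * h ^+ 2 * th ^+ m.
  rewrite /D /y -horner_line_poly -[poly_fun (p m) x](horner_line_poly0 _ _ i).
  rewrite -[poly_fun (mderiv i (p m)) x](horner_line_poly0 _ _ i) -deriv_line_poly.
  rewrite mulrAC; apply: horner_taylor2 => t th_h.
  rewrite !deriv_line_poly horner_line_poly; apply: hK.
  apply: (le_trans (euclidean_norm_line _ _ _)).
  by apply: lerD => //; apply: le_trans th_h (ltW hd).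
have [_ /(_ 0%N)] := series_geometric_bound t0 t1 hD.
rewrite {2}/series /= big_geq // subr0 expr0 mulr1.
have -> : K * h ^+ 2 / (1 - th) = K / (1 - th) * h ^+ 2 by rewrite mulrAC.
congr (`|_| <= _).
have c1 := poly_series_cvg y1.
have c2 := poly_series_cvg x1.
have c3 : cvgn (series (fun m => poly_fun (mderiv i (p m)) x)).
  have [K' [th' [t0' t1' hK']]] := proj2 hp1 _ x1.
  by have [] := series_geometric_bound t0' t1' (fun m => hK' m x (lexx _)).
rewrite !fE // /poly_series.
rewrite -[h * limn _](lim_seriesZ _ c3) -lim_seriesB //.
by rewrite -lim_seriesB //; [apply: is_cvg_seriesB|apply: is_cvg_seriesZ].
Qed.

End Regularity.
End PolynomialSeries.

Lemma poly_series_harmonic (R : realType) (d : nat) (p : nat -> mpoly.mpoly d.+1 R) :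
  geometrically_bounded p -> (forall m x, laplacian (poly_fun (p m)) x = 0) ->
  harmonic_on (@open_unit_ball R d.+1) (poly_series p).
Proof.
move=> hp lap.
have hp1 i := geometrically_bounded_mderiv i hp.
have hp2 i j := geometrically_bounded_mderiv j (hp1 i).
have E1 i x : open_unit_ball x ->
    partial i (poly_series p) x = poly_series (fun m => mderiv i (p m)) x.
  by move=> x1; have [_] := poly_series_derivable hp (fun _ _ => erefl) i x1.
have E2 i j x : open_unit_ball x -> partial j (partial i (poly_series p)) x
    = poly_series (fun m => mderiv j (mderiv i (p m))) x.
  by move=> x1; have [_] := poly_series_derivable (hp1 i) (E1 i) j x1.
split=> x x1.
  split.
  - exact: (poly_series_continuous hp).
  - move=> i; split; last exact: (poly_series_continuous (hp1 i) (E1 i)).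
    by have [] := poly_series_derivable hp (fun _ _ => erefl) i x1.
  - move=> i j; split; last exact: (poly_series_continuous (hp2 i j) (E2 i j)).
    by have [] := poly_series_derivable (hp1 i) (E1 i) j x1.
have lapE m : \sum_(i < d.+1) poly_fun (mderiv i (mderiv i (p m))) x = 0.
  by rewrite -laplacian_poly_fun lap.
rewrite /laplacian; under eq_bigr do rewrite E2 //.
rewrite /poly_series.
have cE i : series (fun m => poly_fun (mderiv i (mderiv i (p m))) x) N @[N --> \oo]
    --> limn (series (fun m => poly_fun (mderiv i (mderiv i (p m))) x)).
  exact: (poly_series_cvg (hp2 i i) x1).
(* The sum of the limits is the limit of the partial sums of the termwise Laplacians, which are all
   zero. *)
have : \sum_(i < d.+1) series (fun m => poly_fun (mderiv i (mderiv i (p m))) x) N @[N --> \oo]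
    --> \sum_(i < d.+1) limn (series (fun m => poly_fun (mderiv i (mderiv i (p m))) x)).
  apply: cvg_big => [z|i _]; last exact: cE.
  by apply: cvgD; [exact: cvg_fst | exact: cvg_snd].
under eq_cvg => N.
  rewrite /series /= exchange_big /= big1; last by move=> m _; exact: lapE.
  over.
by move=> h; have := cvg_unique _ h (cvg_cst 0); apply.
Qed.

Section Homogeneous.
Variables (R : realType) (n m : nat).
Implicit Types p : mpoly.mpoly n R.

Lemma homog_scale p (c : R) (x : 'rV[R]_n) : p \is ishomog1 m (@mdeg n) ->
  poly_fun p (c *: x) = c ^+ m * poly_fun p x.
Proof.
move=> /dhomogP hp; rewrite /poly_fun !mevalE mulr_sumr.
rewrite big_seq [RHS]big_seq; apply: eq_bigr => k /hp /= <-.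
rewrite mulrCA; congr (_ * _); rewrite mdegE -prodrXr -big_split.
by apply: eq_bigr => i _; rewrite mxE exprMn.
Qed.

Lemma homog_msize_le p : p \is ishomog1 m (@mdeg n) -> (msize p <= m.+1)%N.
Proof.
move=> /dhomogP hp; rewrite msizeE; apply/bigmax_leqP_seq => k kp _.
by rewrite (hp _ kp).
Qed.

End Homogeneous.

Lemma poly_fun_sumZ (R : realType) (n : nat) (I : Type) (s : seq I) (c : I -> R)
    (F : I -> mpoly.mpoly n R) x :
  poly_fun (\sum_(i <- s) c i *: F i) x = \sum_(i <- s) c i * poly_fun (F i) x.
Proof. by rewrite /poly_fun raddf_sum; apply: eq_bigr => i _; rewrite /= mevalZ. Qed.

Lemma mderiv_sumZ (R : realType) (n : nat) (I : Type) (s : seq I) (c : I -> R)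
    (F : I -> mpoly.mpoly n R) i :
  mderiv i (\sum_(k <- s) c k *: F k) = \sum_(k <- s) c k *: mderiv i (F k).
Proof.
elim: s => [|k s IH]; first by rewrite !big_nil mderiv0.
by rewrite !big_cons mderivD mderivZ IH.
Qed.

Lemma laplacian_sumZ (R : realType) (d : nat) (I : Type) (s : seq I) (c : I -> R)
    (F : I -> mpoly.mpoly d.+1 R) x :
  (forall i, laplacian (poly_fun (F i)) x = 0) ->
  laplacian (poly_fun (\sum_(i <- s) c i *: F i)) x = 0.
Proof.
move=> hF; rewrite laplacian_poly_fun.
transitivity (\sum_(i <- s) c i * laplacian (poly_fun (F i)) x); last first.
  by rewrite big1 // => i _; rewrite hF mulr0.
under [RHS]eq_bigr do rewrite laplacian_poly_fun mulr_sumr.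
rewrite exchange_big /=; apply: eq_bigr => j _.
by rewrite !(mderiv_sumZ s) poly_fun_sumZ.
Qed.

(** * Harmonic series with controlled partial sums on the sphere *)

Section Growth.
Variables (R : realType) (v : R -> R) (d : nat) (p : nat -> mpoly.mpoly d.+1 R).
Hypotheses (hv : growth_weight v)
  (hom : forall m, p m \is ishomog1 m (@mdeg d.+1))
  (lap : forall m x, laplacian (poly_fun (p m)) x = 0).
Variable C : R.
Hypothesis partial_sums : forall m y, unit_sphere y ->
  `|\sum_(i < m.+1) poly_fun (p i) y| <= C * weight_g v m.+1%:R.

Lemma growth_const_ge0 : 0 <= C.
Proof.
have y1 : unit_sphere (delta_mx ord0 ord0 : 'rV[R]_d.+1).
  by rewrite /unit_sphere /= euclidean_norm_delta.
have := le_trans (normr_ge0 _) (partial_sums 0 y1); rewrite pmulr_lge0 //.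
by apply: lt_le_trans (weight_g_ge1 hv _) => //; rewrite ltr01.
Qed.

Lemma homog_term_bound m y : unit_sphere y ->
  `|poly_fun (p m) y| <= 2 * C * weight_g v m.+1%:R.
Proof.
move=> y1; have C0 := growth_const_ge0.
have h1 := partial_sums m y1.
have g0 k : 0 <= C * weight_g v k.+1%:R.
  by rewrite mulr_ge0 // (le_trans ler01) // weight_g_ge1 // ler1n.
case: m h1 => [|m] h1.
  by move: h1 (g0 0%N); rewrite big_ord1; lra.
have h2 := partial_sums m y1.
have h3 : C * weight_g v m.+1%:R <= C * weight_g v m.+2%:R.
  by apply: ler_wpM2l => //; apply: weight_g_homo => //; rewrite ?ler1n ?ler_nat.
rewrite big_ord_recr /= in h1.
have := ler_normB (\sum_(i < m.+1) poly_fun (p i) y + poly_fun (p m.+1) y)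
  (\sum_(i < m.+1) poly_fun (p i) y).
by rewrite addrAC subrr add0r; lra.
Qed.

Lemma homog_eval m (x y : 'rV[R]_d.+1) : x = euclidean_norm x *: y ->
  poly_fun (p m) x = euclidean_norm x ^+ m * poly_fun (p m) y.
Proof. by move=> {1}->; exact: homog_scale. Qed.

Lemma growth_geometrically_bounded : geometrically_bounded p.
Proof.
split=> [m|rho rho1]; first exact: homog_msize_le.
have [C' C'0 hC'] := weight_g_geometric hv.
(* [rho] may be negative, whereas [weight_g_geometric] takes a radius in [[0, 1)]. *)
pose r := Num.max rho 0.
have r0 : 0 <= r by rewrite le_max lexx orbT.
have r1 : r < 1 by rewrite gt_max rho1 ltr01.
exists (2 * C * (C' * v r)), ((1 + r) / 2); split=> [||m x xr]; [by lra|by lra|].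
have [y y1 xy] := sphere_direction ord0 x.
have xr' : euclidean_norm x <= r by rewrite le_max xr.
have x0 := euclidean_norm_ge0 x.
have C0 := growth_const_ge0.
rewrite (homog_eval m xy) normrM normrX ger0_norm //.
apply: (@le_trans _ _ (r ^+ m * (2 * C * weight_g v m.+1%:R))).
  apply: ler_pM => //; first exact: exprn_ge0.
    by apply: lerXn2r; rewrite ?nnegrE.
  exact: homog_term_bound.
rewrite mulrCA -[leRHS]mulrA; apply: ler_wpM2l; first by rewrite mulr_ge0.
by rewrite mulrC; exact: hC'.
Qed.

Lemma growth_partial_bound : exists2 K : R, 0 < K & forall N x, open_unit_ball x ->
  `|series (fun m => poly_fun (p m) x) N| <= K * v (euclidean_norm x).
Proof.
have [C' C'0 hC'] := weight_g_geometric hv.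
have C0 := growth_const_ge0.
(* The Abel sum contributes [2 C C'] and the boundary term [C C']; 1 is added for positivity. *)
exists (3 * C * C' + 1) => [|N x x1]; first by have : 0 <= C * C' := mulr_ge0 C0 (ltW C'0); lra.
have [y y1 xy] := sphere_direction ord0 x.
have r0 := euclidean_norm_ge0 x.
have r1 : euclidean_norm x < 1 by exact: x1.
set r := euclidean_norm x in xy r0 r1 *.
have v1 : 1 <= v r by exact: (weight_ge1 hv).
have CC : 0 <= C * C' := mulr_ge0 C0 (ltW C'0).
have CCv : 0 <= C * C' * v r by rewrite mulr_ge0 //; lra.
case: N => [|N].
  by rewrite /series /= big_geq // normr0; nra.
rewrite /series /= big_mkord.
under eq_bigr do rewrite (homog_eval _ xy) -/r.
rewrite (abel_geometric (fun m => poly_fun (p m) y)).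
have th1 : (1 + r) / 2 < 1 by lra.
have th0 : 0 <= (1 + r) / 2 by lra.
have h1 : `|(1 - r) * (\sum_(m < N.+1) r ^+ m * \sum_(i < m.+1) poly_fun (p i) y)|
    <= 2 * (C * C' * v r).
  rewrite normrM [X in X * _]ger0_norm; last by lra.
  have : `|\sum_(m < N.+1) r ^+ m * \sum_(i < m.+1) poly_fun (p i) y| <=
      \sum_(m < N.+1) C * C' * v r * ((1 + r) / 2) ^+ m.
    apply: (le_trans (ler_norm_sum _ _ _)); apply: ler_sum => m _.
    rewrite normrM normrX ger0_norm //.
    apply: (le_trans (ler_wpM2l (exprn_ge0 _ r0) (partial_sums m y1))).
    rewrite mulrCA -!mulrA [v r * _]mulrC; apply: ler_wpM2l => //.
    by rewrite mulrC; have := hC' r m r0 r1; lra.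
  rewrite -mulr_sumr => h.
  (* The geometric sum of ratio [(1 + r) / 2] is at most [2 / (1 - r)], which cancels the factor
     [1 - r]. *)
  have := @geometric_tail_le R ((1 + r) / 2) 0 N.+1 th0 th1.
  rewrite big_mkord expr0 => hs.
  apply: (le_trans (ler_wpM2l _ h)); first by lra.
  set S := \sum_(_ < _) _ in hs *.
  have -> : (1 - r) * (C * C' * v r * S) = 2 * (C * C' * v r) * ((1 - (1 + r) / 2) * S) by field.
  by rewrite -[leRHS]mulr1; apply: ler_wpM2l => //; rewrite mulr_ge0.
have h2 : `|r ^+ N.+1 * \sum_(i < N.+1) poly_fun (p i) y| <= C * C' * v r.
  rewrite normrM normrX ger0_norm //.
  apply: (le_trans (ler_wpM2l (exprn_ge0 _ r0) (partial_sums N y1))).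
  have -> : r ^+ N.+1 * (C * weight_g v N.+1%:R) = C * (r * (weight_g v N.+1%:R * r ^+ N)).
    by rewrite exprS; ring.
  rewrite -[leRHS]mulrA; apply: ler_wpM2l => //.
  have g0 : 0 <= weight_g v N.+1%:R * r ^+ N.
    by rewrite mulr_ge0 ?exprn_ge0 // (le_trans ler01) // weight_g_ge1 // ler1n.
  apply: (@le_trans _ _ (weight_g v N.+1%:R * r ^+ N)).
    by rewrite ler_piMl // ltW.
  apply: (le_trans (hC' r N r0 r1)); apply: ler_piMr; first by apply: mulr_ge0; lra.
  by apply: exprn_ile1 => //; exact: ltW.
have := ler_normD ((1 - r) * (\sum_(m < N.+1) r ^+ m * \sum_(i < m.+1) poly_fun (p i) y))
  (r ^+ N.+1 * \sum_(i < N.+1) poly_fun (p i) y).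
by nra.
Qed.

Lemma growth_h_infty :
  (forall x, open_unit_ball x -> cvgn (series (fun m => poly_fun (p m) x))) /\
  h_infty v (poly_series p).
Proof.
have gb := growth_geometrically_bounded.
split; first exact: poly_series_cvg.
split; first exact: poly_series_harmonic.
have [K K0 hK] := growth_partial_bound.
exists K => // x x1; have cx := poly_series_cvg gb x1.
rewrite /poly_series -lim_norm //; apply: limr_le; first exact: is_cvg_norm.
by apply: nearW => N; exact: hK.
Qed.

End Growth.

(** * Partial sums assembled from blocks of degrees *)

Section Blocks.
Variable n : nat -> nat.
Hypothesis hn : forall k, (n k < n k.+1)%N.

Lemma increasing_leq i j : (i <= j)%N -> (n i <= n j)%N.
Proof.
move=> /subnK <-; elim: (j - i)%N => // l IH; rewrite addSn.
exact: leq_trans IH (ltnW (hn _)).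
Qed.

Lemma increasing_gt k : (0 < n 0)%N -> (k < n k)%N.
Proof. by move=> n0; elim: k => // k IH; apply: leq_ltn_trans (hn k). Qed.

Lemma block_index m : (n 0 < m)%N -> exists k, (n k < m <= n k.+1)%N.
Proof.
move=> n0m; have ex : exists k, (m <= n k)%N.
  exists m; elim: m {n0m} => // k IH; exact: leq_ltn_trans IH (hn k).
case: (ex_minnP ex) => -[|k] mk kmin; first by move: n0m; rewrite ltnNge mk.
by exists k; rewrite mk andbT ltnNge; apply/negP => /kmin; rewrite ltnn.
Qed.

Lemma block_index_le m k k' : (n k < m)%N -> (m <= n k'.+1)%N -> (k <= k')%N.
Proof.
move=> km mk'; rewrite leqNgt; apply/negP => /increasing_leq /(leq_trans mk').
by rewrite leqNgt km.
Qed.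

End Blocks.

(** The complete blocks and the unfinished one together cost [K] times the sum of the [b j] up to
    [k + 1], at most [K C2 g (n_(k+1)) <= K C2 C1 g (n_k)], and [n_k < m]. *)
Lemma block_growth (R : realType) (T : Type) (U : nat -> T -> R) (u b : nat -> R)
    (g : R -> R) (n : nat -> nat) (C1 C2 K : R) (N : nat) :
  (forall k, (n k < n k.+1)%N) -> 
  (forall x, 1 <= x -> 1 <= g x) ->
  (forall x y, 1 <= x -> x <= y -> g x <= g y) -> (0 < n 0)%N ->
  0 <= C1 -> 0 <= C2 -> 0 <= K -> (forall j, 0 <= b j) ->
  (forall k, g (n k.+1)%:R <= C1 * g (n k)%:R) ->
  (forall k, \sum_(1 <= j < k.+1) b j <= C2 * g (n k)%:R) ->
  (forall i y, `|U i y| <= u i) ->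
  (forall m k y, (N <= m)%N -> (n k < m <= n k.+1)%N ->
     `|\sum_((n k).+1 <= i < m.+1) U i y| <= K * b k.+1) ->
  exists C : R, forall m y, `|\sum_(i < m.+1) U i y| <= C * g m.+1%:R.
Proof.
move=> hn g1 gh n0 C10 C20 K0 b0 hC1 hC2 hu hU.
have u0 i (y : T) : 0 <= u i by exact: le_trans (hu i y).
have nk k : (k < n k)%N by exact: increasing_gt.
(* The block bounds hold only from degree [N] on; [H] pays for the degrees up to [n N], which
   exceeds [N]. The absolute values keep [H] nonnegative even when [T] is empty. *)
pose H := \sum_(0 <= i < (n N).+1) `|u i|.
have H0 : 0 <= H by apply: sumr_ge0.
have small m y : (m <= n N)%N -> `|\sum_(0 <= i < m.+1) U i y| <= H.
  move=> mN; apply: (le_trans (ler_norm_sum _ _ _)).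
  rewrite /H [leRHS](@big_cat_nat _ _ _ m.+1) //= -[leLHS]addr0; apply: lerD; last exact: sumr_ge0.
  by apply: ler_sum => i _; apply: (le_trans (hu i y)); exact: ler_norm.
have split_at a c y : (a <= c)%N -> \sum_(0 <= i < c.+1) U i y =
    \sum_(0 <= i < a.+1) U i y + \sum_(a.+1 <= i < c.+1) U i y.
  by move=> ac; rewrite (@big_cat_nat _ _ _ a.+1).
have chain k y : (N <= k)%N ->
    `|\sum_(0 <= i < (n k).+1) U i y| <= H + K * \sum_(1 <= j < k.+1) b j.
  elim: k => [|k IH].
    rewrite leqn0 => /eqP N0.
    by rewrite [X in K * X]big_geq // mulr0 addr0 small // N0.
  rewrite leq_eqVlt => /predU1P[<-|Nk].
    by apply: (le_trans (small _ _ (leqnn _))); rewrite lerDl mulr_ge0 // sumr_ge0.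
  rewrite (split_at (n k)); last exact: ltnW.
  apply: (le_trans (ler_normD _ _)).
  rewrite [X in K * X]big_nat_recr //= mulrDr addrA; apply: lerD; first exact: IH.
  apply: hU; last by rewrite hn leqnn.
  by rewrite (leq_trans _ (ltnW (nk _))) // leqW.
exists (H + K * C2 * C1) => m y.
rewrite -(big_mkord xpredT (fun i => U i y)).
have gm : 1 <= g m.+1%:R by apply: g1; rewrite ler1n.
have KC : 0 <= K * C2 * C1 by rewrite !mulr_ge0.
have [mN|Nm] := leqP m (n N).
  by apply: (le_trans (small _ _ mN)); nra.
have [k /andP[Nk kP]] : exists k, (N <= k)%N && (n k < m <= n k.+1)%N.
  have [|k kP] := block_index hn (m := m).
    by apply: leq_ltn_trans Nm; exact: increasing_leq.
  by exists k; rewrite kP andbT (block_index_le hn Nm) //; case/andP: kP.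
have [km mk] := andP kP.
rewrite (split_at (n k)); last exact: ltnW.
apply: (le_trans (ler_normD _ _)).
have h1 := chain k y Nk.
have h2 : `|\sum_((n k).+1 <= i < m.+1) U i y| <= K * b k.+1.
  by apply: hU => //; apply: leq_trans (ltnW km); apply: leq_trans Nk (ltnW (nk k)).
have h3 : K * (\sum_(1 <= j < k.+2) b j) <= K * (C2 * (C1 * g m.+1%:R)).
  apply: ler_wpM2l => //; apply: (le_trans (hC2 _)); apply: ler_wpM2l => //.
  apply: (le_trans (hC1 _)); apply: ler_wpM2l => //.
  apply: gh; first by rewrite ler1n (leq_trans _ (nk k)).
  by rewrite ler_nat; apply: leqW; exact: ltnW.
rewrite big_nat_recr //= mulrDr in h3.
by nra.
Qed.

(** * Almost sure bounds on the blocks *)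

Lemma probability_bigsetU_le (disp : measure_display) (T : measurableType disp)
    (R : realType) (P : probability T R) (I : Type) (s : seq I) (A : I -> set T) (c : R) :
  (forall i, measurable (A i)) -> (forall i, (P (A i) <= c%:E)%E) ->
  (P (\big[setU/set0]_(i <- s) A i) <= ((size s)%:R * c)%:E)%E.
Proof.
move=> mA hA; elim: s => [|i s IH]; first by rewrite big_nil measure0 mul0r.
rewrite big_cons /= -natr1 mulrDl mul1r addrC EFinD.
apply: le_trans (leeD (hA i) IH).
by apply: measureU2 => //; exact: bigsetU_measurable.
Qed.

(** The bounds telescope, with partial sums at most [c], so the upper limit of the events is a null
    set. *)
Lemma borel_cantelli_ae (disp : measure_display) (T : measurableType disp)
    (R : realType) (P : probability T R) (E : nat -> set T) (c : R) :
  (forall m, measurable (E m)) ->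
  (forall m, (P (E m) <= (c / (m.+1%:R * m.+2%:R))%:E)%E) ->
  {ae P, forall w, exists N, forall m, (N <= m)%N -> ~ E m w}.
Proof.
move=> mE hE.
have c0 : 0 <= c.
  have := le_trans (measure_ge0 P (E 0%N)) (hE 0%N).
  by rewrite lee_fin pmulr_lge0 // invr_gt0 mulr_gt0.
exists (lim_sup_set E); split.
- apply: bigcap_measurable => [|k _]; first by exists 0%N.
  by apply: bigcup_measurable => j _; exact: mE.
- apply: lim_sup_set_cvg0 => //; apply: (@le_lt_trans _ _ c%:E); last exact: ltry.
  apply: lime_le; first by apply: is_cvg_nneseries => *; exact: measure_ge0.
  apply: nearW => N.
  apply: (@le_trans _ _ (\sum_(0 <= m < N) (c / (m.+1%:R * m.+2%:R))%:E)%E).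
    by apply: lee_sum => m _; exact: hE.
  rewrite sumEFin lee_fin.
  have -> : \sum_(0 <= m < N) c / (m.+1%:R * m.+2%:R) = c * (1 - N.+1%:R^-1).
    rewrite big_mkord; elim: N => [|N IH]; first by rewrite big_ord0 invr1 subrr mulr0.
    rewrite big_ord_recr /= IH -(natr1 N.+1); field.
    by rewrite nat1r natr1 !pnatr_eq0.
  by rewrite ler_piMr // gerBl invr_ge0.
move=> w /= hw k _; apply: contrapT => nE; apply: hw.
by exists k => m km Em; apply: nE; exists m.
Qed.

Section RandomBlocks.
Context (R : realType) (d : nat) (L : nat -> nat)
  (Y : forall m : nat, 'I_(L m).+1 -> mpoly.mpoly d.+1 R)
  (disp : measure_display) (Omega : measurableType disp)
  (P : probability Omega R) (xi : forall m : nat, 'I_(L m).+1 -> {RV P >-> R})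
  (a : forall m : nat, 'I_(L m).+1 -> R).
Arguments Y : clear implicits.
Arguments xi : clear implicits.
Arguments a : clear implicits.
Hypothesis hY : forall m l, (msize (Y m l) <= m.+1)%N.
Hypothesis hY1 : forall m l (y : 'rV[R]_d.+1), unit_sphere y -> `|poly_fun (Y m l) y| <= 1.
Hypothesis hxi : subnormal_sequence P xi.

Let J : eqType := {m : nat & 'I_(L m).+1}.

Definition random_poly (w : Omega) (m : nat) : mpoly.mpoly d.+1 R :=
  \sum_(l < (L m).+1) (a m l * xi m l w) *: Y m l.

(** Flattens a double sum over degree and index into one over pairs, the index type on which
    independence is stated. *)
Definition block_indices (p q : nat) : seq J :=
  [seq Tagged (fun m => 'I_(L m).+1) l | m <- index_iota p q, l <- enum 'I_(L m).+1].

Lemma block_indices_uniq p q : uniq (block_indices p q).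
Proof.
apply: allpairs_uniq_dep => [|m _|[m l] [m' l'] _ _ //]; first exact: iota_uniq.
exact: enum_uniq.
Qed.

Lemma sum_block_indices p q (F : forall m, 'I_(L m).+1 -> R) :
  \sum_(j <- block_indices p q) F (tag j) (tagged j) =
  \sum_(p <= m < q) \sum_(l < (L m).+1) F m l.
Proof.
rewrite big_allpairs_dep /=; apply: eq_bigr => m _.
by rewrite big_enum.
Qed.

Lemma msize_random_block w p q :
  (msize (\sum_(p <= i < q.+1) random_poly w i) <= q.+1)%N.
Proof.
apply: (leq_trans (msize_sum _ _ _)); apply/bigmax_leqP_seq => i.
rewrite mem_index_iota => /andP[_ iq] _.
apply: (leq_trans (msize_sum _ _ _)); apply/bigmax_leqP_seq => l _ _.
apply: (leq_trans (msizeZ_le _ _)); apply: leq_trans (hY l) _ => //.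
Qed.

(** At a fixed [y] the block is a linear combination of the [xi m l] with coefficients
    [a m l * Y_ml(y)], and [|Y_ml(y)| <= 1] bounds the sum of their squares. *)
Lemma random_block_tail p q (y : 'rV[R]_d.+1) (sg tau : R) :
  unit_sphere y -> 0 <= sg -> 0 <= tau ->
  \sum_(p <= i < q) coef_sqnorm a i <= sg ^+ 2 ->
  measurable [set w | sg * tau < `|poly_fun (\sum_(p <= i < q) random_poly w i) y|] /\
  (P [set w | (sg * tau < `|poly_fun (\sum_(p <= i < q) random_poly w i) y|)%R]
     <= (2 * expR (- (tau ^+ 2 / 2)))%:E)%E.
Proof.
move=> y1 sg0 tau0 hsg.
have [indep subn] := hxi.
pose X (j : J) := xi (tag j) (tagged j).
pose c (j : J) := a (tag j) (tagged j) * poly_fun (Y (tag j) (tagged j)) y.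
have E w : poly_fun (\sum_(p <= i < q) random_poly w i) y
    = \sum_(j <- block_indices p q) c j * X j w.
  rewrite (sum_block_indices p q (fun m l => a m l * poly_fun (Y m l) y * xi m l w)).
  rewrite /poly_fun raddf_sum /=; apply: eq_bigr => m _.
  rewrite -/(poly_fun _ y) poly_fun_sumZ; apply: eq_bigr => l _; ring.
have -> : [set w | sg * tau < `|poly_fun (\sum_(p <= i < q) random_poly w i) y|]
  = [set w | sg * tau < `|\sum_(j <- block_indices p q) c j * X j w|].
  by apply/seteqP; split=> w /=; rewrite E.
split.
  rewrite -[X in measurable X]setTI.
  have mZ : measurable_fun setT (fun w => `|\sum_(j <- block_indices p q) c j * X j w|).
    by apply: measurableT_comp => //; exact: (measurable_linear_comb X).
  have := mZ measurableT `]sg * tau, +oo[%classic (measurable_itv _).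
  by congr (measurable (_ `&` _)); apply/seteqP; split=> w /=; rewrite in_itv /= andbT.
apply: subgaussian_tail => //; first by move=> j; exact: subn.
  exact: block_indices_uniq.
apply: le_trans hsg.
rewrite (sum_block_indices p q (fun m l => (a m l * poly_fun (Y m l) y) ^+ 2)).
apply: ler_sum => m _; apply: ler_sum => l _.
rewrite exprMn ler_piMr ?sqr_ge0 // -real_normK ?num_real //.
by rewrite exprn_ile1 // hY1.
Qed.

Variable n : nat -> nat.
Hypotheses (hn0 : (0 < n 0)%N) (hn : forall k, (n k < n k.+1)%N).

Let b j := Num.sqrt ((\sum_((n j.-1).+1 <= m < (n j).+1) coef_sqnorm a m) * ln (n j)%:R).
(** Here [lam^2 / 2 = 2 (d + 2)], so at [tau = lam sqrt (log m)] the tail decays like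
    [m^(-2 (d + 2))], which beats the size of the net. *)
Let lam : R := 2 * Num.sqrt d.+2%:R.

(* For degree m >= 2 the net has at most (m^2 + 1)^(d + 1) points and each tail
   event has probability at most 2 m^-(2 (d + 2)), whence O(1 / m^2) overall. *)
Lemma random_block_bound : {ae P, forall w, exists N, forall m k y,
  (N <= m)%N -> (n k < m <= n k.+1)%N -> unit_sphere y ->
  `|poly_fun (\sum_((n k).+1 <= i < m.+1) random_poly w i) y|
     <= 2 * 4 ^+ d.+1 * lam * b k.+1}.
Proof.
have /choice [s hs] : forall m, exists t : seq 'rV[R]_d.+1, (0 < m)%N ->
    [/\ (size t <= (m ^ 2).+1 ^ d.+1)%N, forall y, y \in t -> unit_sphere y
      & forall (p : mpoly.mpoly d.+1 R) (B : R), 0 <= B -> (msize p <= m.+1)%N ->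
        (forall y, y \in t -> `|poly_fun p y| <= B) ->
        forall x, unit_sphere x -> `|poly_fun p x| <= 2 * 4 ^+ d.+1 * B].
  move=> m; have [m0|m0] := ltnP 0 m; last by exists [::].
  by have [t ht] := sphere_net R d.+1 m0; exists t.
have /choice [kk hkk] : forall m, exists k, (n 0 < m)%N -> (n k < m <= n k.+1)%N.
  move=> m; have [m0|m0] := ltnP (n 0) m; last by exists 0%N.
  by have [k hk] := block_index hn m0; exists k.
(* The variance of the whole block is used even when the sum stops at [m], so as to match [b]. *)
pose sg m := Num.sqrt (\sum_((n (kk m)).+1 <= i < (n (kk m).+1).+1) coef_sqnorm a i).
pose tau m : R := lam * Num.sqrt (ln m%:R).
have cs0 i : 0 <= coef_sqnorm a i by apply: sumr_ge0 => l _; exact: sqr_ge0.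
have lam0 : 0 <= lam by rewrite mulr_ge0 ?sqrtr_ge0.
have tau0 m : 0 <= tau m by rewrite mulr_ge0 ?sqrtr_ge0.
(* The clause [unit_sphere y] empties the event off the sphere, so its bound holds for every [y], as
   [probability_bigsetU_le] demands. *)
pose A m y := [set w | unit_sphere y /\ (sg m * tau m <
  `|poly_fun (\sum_((n (kk m)).+1 <= i < m.+1) random_poly w i) y|)%R].
pose E m := if (n 0 < m)%N then \big[setU/set0]_(y <- s m) A m y else set0.
have hA m y : (n 0 < m)%N -> measurable (A m y) /\
    (P (A m y) <= (2 * expR (- (tau m ^+ 2 / 2)))%:E)%E.
  move=> nm; have [y1|ny1] := pselect (unit_sphere y); last first.
    have -> : A m y = set0 by apply/seteqP; split=> w //= -[].
    by split=> //; rewrite measure0 lee_fin mulr_ge0 // expR_ge0.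
  have -> : A m y = [set w | sg m * tau m <
     `|poly_fun (\sum_((n (kk m)).+1 <= i < m.+1) random_poly w i) y|].
    by apply/seteqP; split=> w /=; [case|split].
  apply: random_block_tail => //; first exact: sqrtr_ge0.
  rewrite sqr_sqrtr ?sumr_ge0 //.
  have /andP[km mk] := hkk m nm.
  rewrite [leRHS](@big_cat_nat _ _ _ m.+1) //=; last by rewrite ltnS ltnW.
  by rewrite lerDl sumr_ge0.
have mE m : measurable (E m).
  rewrite /E; case: ifP => // nm; apply: bigsetU_measurable => y _.
  by have [] := hA m y nm.
have tail m : (1 < m)%N -> expR (- (tau m ^+ 2 / 2)) = (m%:R ^+ (2 * d.+2))^-1 :> R.
  move=> m1; have l0 : 0 <= ln (m%:R : R) by rewrite ln_ge0 // ler1n ltnW.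
  rewrite expRN; congr (_^-1).
  rewrite -[m%:R in RHS]lnK ?posrE ?ltr0n ?(ltnW m1) // -expRM_natl; congr expR.
  by rewrite /tau /lam !exprMn !sqr_sqrtr // natrM; field.
(* The bound [(m^2 + 1)^(d+1) <= (2 m^2)^(d+1)] on the net makes the total [2^(d+2) / m^2]; the 6
   comes from [(m + 1) (m + 2) <= 6 m^2]. *)
have PE m : (P (E m) <= (6 * 2 ^+ d.+2 / (m.+1%:R * m.+2%:R))%:E)%E.
  rewrite /E; case: ifP => nm; last first.
    by rewrite measure0 lee_fin divr_ge0 // mulr_ge0.
  have m1 : (1 < m)%N by apply: leq_ltn_trans nm.
  apply: (le_trans (@probability_bigsetU_le _ _ _ _ _ _ _
      (2 * expR (- (tau m ^+ 2 / 2))) _ _)) => [y|y|].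
  - by have [] := hA m y nm.
  - by have [] := hA m y nm.
  rewrite lee_fin (tail _ m1).
  have [sz _ _] := hs m (ltnW m1).
  have M2 : 2 <= m%:R :> R by rewrite ler_nat.
  have : (size (s m))%:R <= (2 * m%:R ^+ 2) ^+ d.+1 :> R.
    apply: (@le_trans _ _ ((m ^ 2).+1 ^ d.+1)%:R); first by rewrite ler_nat.
    rewrite natrX; apply: lerXn2r; rewrite ?nnegrE ?mulr_ge0 ?exprn_ge0 //.
    by rewrite -natr1 natrX; nra.
  rewrite exprMn -exprM => hsz.
  have X0 : 0 < m%:R ^+ (2 * d.+2) :> R by rewrite exprn_gt0 // ltr0n ltnW.
  apply: (le_trans (ler_wpM2r _ hsz)); first by rewrite mulr_ge0 // invr_ge0 ltW.
  have -> : 2 ^+ d.+1 * m%:R ^+ (2 * d.+1) * (2 * (m%:R ^+ (2 * d.+2))^-1)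
     = 2 ^+ d.+2 * (m%:R ^+ 2)^-1 :> R.
    rewrite (mulnS 2 d.+1) (exprD _ 2) (exprS 2 d.+1); field.
    by rewrite expf_neq0 //= ?andbT pnatr_eq0 -lt0n ltnW.
  rewrite [6 * _]mulrC -[leRHS]mulrA; apply: ler_wpM2l; first exact: exprn_ge0.
  have m2 : 0 < m%:R ^+ 2 :> R by rewrite exprn_gt0 // ltr0n ltnW.
  rewrite ler_pdivlMr ?mulr_gt0 // mulrC ler_pdivrMr //.
  by rewrite -(natr1 m.+1) -(natr1 m); nra.
apply: filterS (borel_cantelli_ae mE PE) => w [N hN].
exists N => m k y Nm /andP[km mk] y1.
have nm : (n 0 < m)%N by apply: leq_ltn_trans km; exact: increasing_leq.
have /andP[km' mk'] := hkk m nm.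
have ek : kk m = k.
  by apply/eqP; rewrite eqn_leq (block_index_le hn km' mk) (block_index_le hn km mk').
have m0 : (0 < m)%N by apply: leq_ltn_trans nm.
have [_ hsp net] := hs m m0.
have h : forall z, z \in s m ->
    `|poly_fun (\sum_((n k).+1 <= i < m.+1) random_poly w i) z| <= sg m * tau m.
  move=> z zs; rewrite leNgt; apply/negP => lt; apply: (hN m Nm).
  rewrite /E nm -bigcup_seq; exists z => //=.
  by split; [exact: hsp | rewrite ek].
apply: le_trans (net _ _ _ (msize_random_block w _ _) h y y1) _.
  by rewrite mulr_ge0 ?sqrtr_ge0.
rewrite -[leRHS]mulrA; apply: ler_wpM2l; first by rewrite mulr_ge0 ?exprn_ge0.
rewrite /tau mulrCA; apply: ler_wpM2l => //.
rewrite /sg ek /b sqrtrM ?sumr_ge0 //; apply: ler_wpM2l; first exact: sqrtr_ge0.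
rewrite ler_wsqrtr // ler_ln ?posrE ?ltr0n //; last by apply: leq_trans mk.
by rewrite ler_nat.
Qed.

End RandomBlocks.

(** * Almost sure membership in the weighted harmonic class *)

Unset Implicit Arguments.

Theorem theorem3p1 (R : realType) (d : nat) (hd : (1 <= d)%N)
  (v : R -> R) (hv : growth_weight v)
  (L : nat -> nat) (Y : forall m : nat, 'I_(L m).+1 -> mpoly.mpoly d.+1 R)
  (hY : forall m l, spherical_harmonic m (Y m l))
  (hY1 : forall m l (y : 'rV[R]_d.+1), unit_sphere y ->
     `|poly_fun (Y m l) y| <= 1)
  (disp : measure_display) (Omega : measurableType disp)
  (P : probability Omega R)
  (xi : forall m : nat, 'I_(L m).+1 -> {RV P >-> R})
  (hxi : subnormal_sequence P xi)
  (a : forall m : nat, 'I_(L m).+1 -> R)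
  (n : nat -> nat) (hn0 : (0 < n 0)%N) (hn : forall k, (n k < n k.+1)%N)
  (C1 C2 : R) (hC1 : 0 < C1) (hC2 : 0 < C2)
  (hg : forall k, weight_g v (n k.+1)%:R <= C1 * weight_g v (n k)%:R)
  (ha : forall k,
     \sum_(1 <= j < k.+1)
       Num.sqrt ((\sum_((n j.-1).+1 <= m < (n j).+1) coef_sqnorm a m)
                 * ln (n j)%:R)
     <= C2 * weight_g v (n k)%:R) :
  {ae P, forall w,
     let term := expansion_term Y (fun m l => a m l * xi m l w) in
     (forall x, open_unit_ball x -> cvgn (series (term x))) /\
     h_infty v (fun x => limn (series (term x)))}.
Proof.
have msY m l : (msize (Y m l) <= m.+1)%N by apply: homog_msize_le; have [] := hY m l.
pose b j := Num.sqrt ((\sum_((n j.-1).+1 <= m < (n j).+1) coef_sqnorm a m)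
                      * ln (n j)%:R).
(* From here on [w] is fixed and the argument is deterministic. *)
apply: filterS (random_block_bound a msY hY1 hxi hn0 hn) => w [N hN] /=.
set term := expansion_term Y _.
pose p := random_poly Y xi a w.
have termE x : term x = (fun m => poly_fun (p m) x).
  apply/funext => m; rewrite /term /expansion_term /p /random_poly poly_fun_sumZ.
  apply: eq_bigr => l _; have [hom _] := hY m l.
  rewrite -mulrA -(homog_scale _ _ hom) scalerA.
  (* Homogeneity has moved [r^m] inside as the scalar [r * r^-1]. At the origin this scalar is 0
     rather than 1, but there [0 *: x] is still [x]. *)
  have [x0|x0] := eqVneq (euclidean_norm x) 0; last by rewrite mulfV // scale1r.
  rewrite x0 mul0r scale0r; congr (_ * poly_fun _ _); apply/rowP => i.
  by rewrite mxE; apply/esym/eqP; rewrite -normr_le0 -x0 coord_le_euclidean_norm.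
have hom m : p m \is ishomog1 m (@mdeg d.+1).
  rewrite /p /random_poly; apply: rpred_sum => l _; apply: rpredZ.
  by have [] := hY m l.
have lap m x : laplacian (poly_fun (p m)) x = 0.
  apply: laplacian_sumZ => l; have [_ [_ ->]] := hY m l => //.
pose sphere := {y : 'rV[R]_d.+1 | unit_sphere y}.
have [C hC] : exists C : R, forall m (y : sphere),
    `|\sum_(i < m.+1) poly_fun (p i) (sval y)| <= C * weight_g v m.+1%:R.
  apply: (@block_growth R sphere (fun i y => poly_fun (p i) (sval y))
    (fun i => \sum_(l < (L i).+1) `|a i l * xi i l w|) b (weight_g v)
    n C1 C2 (2 * 4 ^+ d.+1 * (2 * Num.sqrt d.+2%:R)) N) => //.
  - by move=> x; exact: weight_g_ge1.
  - by move=> x y; exact: weight_g_homo.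
  - exact: ltW.
  - exact: ltW.
  - by move=> j; exact: sqrtr_ge0.
  - move=> i y; rewrite /p /random_poly poly_fun_sumZ.
    apply: (le_trans (ler_norm_sum _ _ _)); apply: ler_sum => l _.
    by rewrite normrM ler_piMr // hY1 //; exact: svalP.
  - move=> m k y Nm km.
    (* The sum of values is regrouped as the value of one polynomial, the form in which the net
       bound [hN] is stated. *)
    rewrite -[X in `|X|](_ : poly_fun (\sum_((n k).+1 <= i < m.+1) p i) (sval y) = _).
      by apply: hN => //; exact: svalP.
    by rewrite /poly_fun raddf_sum.
have [cvg_u hu] := growth_h_infty hv hom lap (fun m y y1 => hC m (exist _ y y1)).
split=> [x x1|]; first by rewrite termE; exact: cvg_u.
rewrite (_ : (fun x => limn (series (term x))) = poly_series p) //.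
by apply/funext => x; rewrite termE.
Qed.
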